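(* Let $n\ge 2$ and let $X$ and $Y$ be $n$-dimensional vector spaces over $\mathbb{F}_2$. Let $\mathcal G(n)$ be the group with underlying set $X\oplus Y\oplus(X\otimes Y)$ and multiplication $g_1g_2=g_1+g_2+x_2\otimes y_1$ for $g_i=x_i+y_i+A_i$ ($x_i\in X$, $y_i\in Y$, $A_i\in X\otimes Y$, $i=1,2$). Let $\Gamma(n)=C(\mathcal G(n),X,Y)$, $\Sigma(n)=\Sigma(\mathcal G(n),X,Y)$, $S=(X\cup Y)\setminus\{0\}$ and $N=\mathcal G(n)'$ (the derived subgroup). Then (1) $\mathrm{Aut}(\Gamma(n))=\mathrm{Aut}(\Sigma(n))=\mathcal G(n):\mathrm{Aut}(\mathcal G(n),S)\cong \mathcal G(n):(\mathrm{GL}_n(2)\wr S_2)$. (2) $\Sigma(n)$ is a $2$-arc-transitive graph of order $2^{n^2+n+1}$, and an $N$-normal cover of $\mathbf{K}_{2^n,2^n}$; and $\mathbf{K}_{2^n,2^n}\cong\Sigma(n)_N$ is $\mathrm{Aut}(\Sigma(n))/N$-edge-affine, and in particular is $\mathcal G(n)/N$-edge-affine.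
   Context: All graphs are finite, connected, simple and undirected; the order of a graph is its number of vertices. The tensor product is over $\mathbb F_2$, and all additions in the multiplication are in the vector space $X\oplus Y\oplus (X\otimes Y)$; the identity of $\mathcal G(n)$ is $0$. $X$ and $Y$ are regarded as subgroups of $\mathcal G(n)$. $A:B$ denotes a semidirect product with normal subgroup $A$. For a finite group $H$ and inverse-closed $S\subseteq H\setminus\{1\}$, $\mathrm{Cay}(H,S)$ has vertex set $H$ and edges $\{g,sg\}$ ($g\in H,s\in S$). $H$ is identified with the group of right multiplications, which is a regular subgroup of $\mathrm{Aut}(\mathrm{Cay}(H,S))$, and $\mathrm{Aut}(H,S)=\{\alpha\in\mathrm{Aut}(H): S^\alpha=S\}$. For a group $H$ with subgroups $X,Y$ such that $X\cong Y\cong C_2^n$, $H=\langle X\cup Y\rangle$, $H/H'\cong C_2^{2n}$ (as is the case for $\mathcal G(n)$): $C(H,X,Y)=\mathrm{Cay}(H,(X\cup Y)\setminus\{1\})$, and $\Sigma(H,X,Y)$ is the graph with vertex set $\{Xh: h\in H\}\cup\{Yh: h\in H\}$ and edge set $\{\{Xh,Yg\}: h,g\in H,\ Xh\cap Yg\neq\emptyset\}$. The vertices $Xh$, $Yh$ of $\Sigma(H,X,Y)$ are precisely the maximal cliques of $C(H,X,Y)$, and $\mathrm{Aut}(C(H,X,Y))$ is regarded as acting on $\Sigma(H,X,Y)$ via its action on these cliques; the equality $\mathrm{Aut}(\Gamma(n))=\mathrm{Aut}(\Sigma(n))$ is with respect to this identification. A $2$-arc is a triple $(u,v,w)$ of vertices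 with $u\neq w$ and $\{u,v\},\{v,w\}$ edges; a graph is $2$-arc-transitive if its automorphism group is transitive on $2$-arcs. For $N\lhd G\leq \mathrm{Aut}(\Sigma)$ with $G$ transitive on $V(\Sigma)$, the $N$-normal quotient $\Sigma_N$ has as vertices the $N$-orbits in $V(\Sigma)$, two distinct $N$-orbits being adjacent if some edge of $\Sigma$ has one end in each. $\Sigma$ is an $N$-normal cover of a graph $\Delta$ if, for some such $G$, $\Sigma_N\cong\Delta$ and $\Sigma,\Delta$ have the same valency. $\mathbf{K}_{2^n,2^n}$ is $L$-edge-affine if $L\leq S_{2^n}\wr S_2=\mathrm{Aut}(\mathbf{K}_{2^n,2^n})$ and $L$ has a normal subgroup isomorphic to $C_2^n\times C_2^n$ that is intransitive on vertices and regular on edges (here $L$ is the stated quotient group in its induced faithful action on $\Sigma(n)_N$). *)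

(* Defs.v *)
From HB Require Import structures.
From mathcomp Require Import all_boot all_order all_algebra all_fingroup all_solvable.

Set Implicit Arguments.
Unset Strict Implicit.
Unset Printing Implicit Defensive.

Import GRing.Theory passmx.
Local Open Scope group_scope.

Definition is_graph (V : finType) (e : rel V) : Prop :=
  [/\ symmetric e, irreflexive e & forall u v, connect e u v].

Definition graph_iso (V W : finType) (e : rel V) (d : rel W) : Prop :=
  exists2 f : V -> W, bijective f & forall u v, d (f u) (f v) = e u v.

Definition has_valency (V : finType) (e : rel V) (k : nat) : Prop :=
  forall v, #|[set w | e v w]| = k.

Definition edges (V : finType) (e : rel V) : {set {set V}} :=
  [set [set p.1; p.2] | p : V * V & e p.1 p.2].

Section GraphAut.
Variables (V : finType) (e : rel V).

Definition autg : {set {perm V}} :=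
  [set p : {perm V} | [forall u, forall v, e (p u) (p v) == e u v]].

Lemma autgP (p : {perm V}) : reflect (forall u v, e (p u) (p v) = e u v) (p \in autg).
Proof.
rewrite inE; apply: (iffP forallP) => [H u v | H u].
  by apply/eqP; move/forallP: (H u); apply.
by apply/forallP=> v; apply/eqP.
Qed.

Lemma autg_group_set : group_set autg.
Proof.
apply/group_setP; split; first by apply/autgP=> u v; rewrite !perm1.
by move=> p q /autgP Hp /autgP Hq; apply/autgP=> u v; rewrite !permM Hq Hp.
Qed.
Canonical autg_group := Group autg_group_set.

Definition two_arc (u v w : V) : bool := [&& e u v, e v w & u != w].

Definition two_arc_transitive : Prop :=
  forall u v w u' v' w', two_arc u v w -> two_arc u' v' w' ->
  exists2 p, p \in autg & [/\ p u = u', p v = v' & p w = w'].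

End GraphAut.

Definition complete_bipartite (m : nat) : rel ('I_m + 'I_m) :=
  fun u v => match u, v with
             | inl _, inr _ | inr _, inl _ => true
             | _, _ => false
             end.

Record block (T : finType) (F : {set {set T}}) :=
  Block { block_set :> {set T}; _ : block_set \in F }.
HB.instance Definition _ T F := [isSub for @block_set T F].
HB.instance Definition _ T F := [Finite of @block T F by <:].

(* The induced map on blocks is [A |-> p @: A] for those [p] that preserve [F];
   all other [p] are outside the domain of the morphism [block_perm F]. *)
Definition block_dom (T : finType) (F : {set {set T}}) : {group {perm T}} :=
  [group of subact_dom (mem F) 'P^*].

Definition block_perm (T : finType) (F : {set {set T}}) :
    {morphism block_dom F >-> {perm block F}} :=
  actperm_morphism (subaction (block F) 'P^*).

Lemma block_permE (T : finType) (F : {set {set T}}) p (A : block F) :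
  p \in block_dom F -> block_perm F p A = p @: A :> {set T}.
Proof. by move=> Fp; rewrite actpermE /= [LHS]val_subact Fp. Qed.

Section NormalQuotient.
Variables (V : finType) (e : rel V) (N : {group {perm V}}).

Definition orbits : {set {set V}} := orbit 'P N @: [set: V].

Definition quotient_graph : rel (block orbits) := fun B C =>
  (B != C) && [exists u in (B : {set V}), exists v in (C : {set V}), e u v].

Definition normal_cover (W : finType) (d : rel W) : Prop :=
  exists G : {group {perm V}},
    [/\ N <| G, G \subset autg e, [transitive G, on [set: V] | 'P],
        graph_iso quotient_graph d
      & exists k, has_valency e k /\ has_valency d k].

End NormalQuotient.
Arguments quotient_graph {V} e N.

(* The additive group of ['rV['F_2]_n] is C_2^n. *)
Definition edge_affine (n : nat) (V : finType) (e : rel V)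
    (L : {group {perm V}}) : Prop :=
  [/\ graph_iso e (@complete_bipartite (2 ^ n)),
      L \subset autg e
    & exists M : {group {perm V}},
        [/\ M <| L,
            M \isog setX [set: 'rV['F_2]_n] [set: 'rV['F_2]_n],
            ~~ [transitive M, on [set: V] | 'P],
            [transitive M, on edges e | 'P^*]
          & {in edges e, forall E, 'C_M[E | 'P^*] = 1}]].

(* L/N is realised as the image of L in the symmetric group on the N-orbits;
   the induced action of L/N is faithful since N is the kernel. *)
Definition quotient_edge_affine (n : nat) (V : finType) (e : rel V)
    (L N : {group {perm V}}) : Prop :=
  [/\ N <| L, L \subset autg e, L \subset block_dom (orbits N),
      'ker_L (block_perm (orbits N)) = N
    & edge_affine n (quotient_graph e N)
                    (block_perm (orbits N) @* L)%G].

Section CayleyCoset.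
Variable gT : finGroupType.

Definition cayley (S : {set gT}) : rel gT := fun g h => h * g^-1 \in S.

Definition right_reg : {morphism [set: gT] >-> {perm gT}} :=
  actperm_morphism 'R.

Definition aut_set (S : {set gT}) : {set {perm gT}} :=
  [set a in Aut [set: gT] | a @: S == S].

Variables X Y : {group gT}.

Definition connection_set : {set gT} := (X :|: Y) :\ 1.

Definition C_graph : rel gT := cayley connection_set.

Definition cosets : {set {set gT}} :=
  rcosets X [set: gT] :|: rcosets Y [set: gT].

Definition Sigma_graph : rel (block cosets) := fun A B =>
  [|| (block_set A \in rcosets X [set: gT]) && (block_set B \in rcosets Y [set: gT])
    | (block_set A \in rcosets Y [set: gT]) && (block_set B \in rcosets X [set: gT])]
  && (block_set A :&: block_set B != set0).

(* A subgroup of [gT], acting by right multiplication, as a group of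
   permutations of the vertices of [Sigma_graph]. *)
Definition on_Sigma (H : {group gT}) : {group {perm block cosets}} :=
  (block_perm cosets @* (right_reg @* H))%G.

End CayleyCoset.
Arguments Sigma_graph {gT} X Y.
Arguments on_Sigma {gT} X Y H.

Definition isog_semidirect (gT aT bT : finGroupType)
    (L : {group gT}) (A : {group aT}) (B : {group bT}) : Prop :=
  exists to : groupAction B A, L \isog [set: sdprod_by to].

Section Wreath.
Variables (gT : finGroupType) (k : nat).

Definition power_group : finGroupType := {dffun forall i : 'I_k, gT}.

Definition wreath_act (f : power_group) (s : 'S_k) : power_group :=
  [ffun i => f (s^-1 i)].

Lemma wreath_act_is_action : is_action [set: 'S_k] wreath_act.
Proof.
apply: is_total_action => [f | f s t]; apply/ffunP=> i; rewrite !ffunE.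
  by rewrite invg1 perm1.
by rewrite invMg permM.
Qed.
Canonical wreath_action := Action wreath_act_is_action.

Lemma wreath_act_is_groupAction :
  is_groupAction [set: power_group] wreath_action.
Proof.
move=> s _; rewrite inE; apply/andP; split.
  by apply/subsetP=> f _; rewrite inE.
apply/morphicP=> f g _ _; rewrite !actpermE /=.
by apply/ffunP=> i; rewrite !ffunE.
Qed.
Canonical wreath_groupAction := GroupAction wreath_act_is_groupAction.

Definition wreath : finGroupType := sdprod_by wreath_groupAction.

End Wreath.

Section Coordinates.
Variable V : vectType 'F_2.

Definition coords (v : V) : 'rV['F_2]_(\dim {:V}) := rVof (vbasis {:V}) v.
Definition of_coords (r : 'rV['F_2]_(\dim {:V})) : V := vecof (vbasis {:V}) r.

Lemma coords_is_linear : linear coords.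
Proof. exact: rVof_linear. Qed.
HB.instance Definition _ :=
  GRing.isLinear.Build 'F_2 V 'rV['F_2]_(\dim {:V}) _ coords coords_is_linear.

Lemma of_coords_is_linear : linear of_coords.
Proof. exact: vecof_linear. Qed.
HB.instance Definition _ :=
  GRing.isLinear.Build 'F_2 'rV['F_2]_(\dim {:V}) V _ of_coords of_coords_is_linear.

Lemma coordsK : cancel coords of_coords.
Proof. exact/rVofK/vbasisP. Qed.
Lemma of_coordsK : cancel of_coords coords.
Proof. exact/vecofK/vbasisP. Qed.

End Coordinates.

(* The tensor product of X and Y is realised by matrices, with respect to the
   bases [vbasis {:X}] and [vbasis {:Y}]; [tensor_universal] is its universal
   property. *)
Section Tensor.
Local Open Scope ring_scope.
Variables X Y : vectType 'F_2.

Definition tensor : Type := 'M['F_2]_(\dim {:X}, \dim {:Y}).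
HB.instance Definition _ := Vector.on tensor.
HB.instance Definition _ := Finite.on tensor.

Definition tens (x : X) (y : Y) : tensor := (coords x)^T *m coords y.

Lemma tens_is_bilinear : bilinear_for *:%R *:%R tens.
Proof.
split=> [y a u v | x a u v]; rewrite /tens.
  by rewrite linearP /= linearP /= mulmxDl scalemxAl.
by rewrite linearP /= mulmxDr scalemxAr.
Qed.
HB.instance Definition _ :=
  bilinear_isBilinear.Build 'F_2 X Y tensor _ _ tens tens_is_bilinear.

Lemma tensor_universal (W : lmodType 'F_2) (b : {bilinear X -> Y -> W}) :
  exists2 f : {linear tensor -> W}, (forall x y, f (tens x y) = b x y)
    & forall g : {linear tensor -> W},
        (forall x y, g (tens x y) = b x y) -> g =1 f.
Proof.
pose ex i : X := of_coords (delta_mx 0 i).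
pose ey j : Y := of_coords (delta_mx 0 j).
pose f0 (A : tensor) : W := \sum_i \sum_j A i j *: b (ex i) (ey j).
have f0_lin : linear f0.
  move=> a A B; rewrite /f0 scaler_sumr -big_split; apply: eq_bigr => i _ /=.
  rewrite scaler_sumr -big_split; apply: eq_bigr => j _ /=.
  by rewrite !mxE scalerDl scalerA.
pose fM := GRing.isLinear.Build 'F_2 tensor W *:%R f0 f0_lin.
pose f : {linear tensor -> W} := HB.pack f0 fM.
exists f => [x y | g Hg A].
  rewrite /f /= /f0.
  have decomp (V : vectType 'F_2) (v : V) :
      v = \sum_i coords v 0 i *: of_coords (delta_mx 0 i).
    rewrite -[LHS]coordsK [X in of_coords X]row_sum_delta linear_sum.
    by apply: eq_bigr => i _; rewrite linearZ.
  rewrite [in RHS](decomp X x) linear_sumlz; apply: eq_bigr => i _.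
  rewrite linearZl_LR /= [in RHS](decomp Y y) linear_sumr scaler_sumr.
  apply: eq_bigr => j _; rewrite linearZr_LR /= scalerA; congr (_ *: _).
  by rewrite /tens mxE big_ord1 !mxE.
rewrite /f /= /f0 [in LHS](matrix_sum_delta A) linear_sum.
apply: eq_bigr => i _; rewrite linear_sum; apply: eq_bigr => j _.
rewrite linearZ /=; congr (_ *: _); rewrite -Hg /tens !of_coordsK; congr (g _).
by rewrite trmx_delta mul_delta_mx.
Qed.

End Tensor.

Section CalG.
Variables X Y : vectType 'F_2.
Local Open Scope ring_scope.

Record calG := CalG { xpart : X; ypart : Y; tpart : tensor X Y }.

Definition calG_code (g : calG) :=
  (coords (xpart g), coords (ypart g), tpart g).
Definition calG_decode (c : 'rV['F_2]_(\dim {:X}) * 'rV['F_2]_(\dim {:Y})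
                            * tensor X Y) :=
  CalG (of_coords c.1.1) (of_coords c.1.2) c.2.
Lemma calG_codeK : cancel calG_code calG_decode.
Proof. by case=> x y A; rewrite /calG_decode /= !coordsK. Qed.
HB.instance Definition _ := Finite.copy calG (can_type calG_codeK).

Definition calG_mul (g h : calG) : calG :=
  CalG (xpart g + xpart h) (ypart g + ypart h)
       (tpart g + tpart h + tens (xpart h) (ypart g)).
Definition calG_one : calG := CalG 0 0 0.
Definition calG_inv (g : calG) : calG :=
  CalG (- xpart g) (- ypart g) (- tpart g + tens (xpart g) (ypart g)).

Lemma calG_mulA : associative calG_mul.
Proof.
move=> [x1 y1 A1] [x2 y2 A2] [x3 y3 A3]; rewrite /calG_mul /= !addrA.
congr CalG; rewrite linearDl linearDr /= !addrA.
by rewrite [LHS](ACl (1*2*5*3*6*4)).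
Qed.

Lemma calG_mul1 : left_id calG_one calG_mul.
Proof. by case=> x y A; rewrite /calG_mul /= linear0r !add0r addr0. Qed.

Lemma calG_mulV : left_inverse calG_one calG_inv calG_mul.
Proof.
case=> x y A; rewrite /calG_mul /= linearNr /= !addNr.
by rewrite addrAC addrK addNr.
Qed.

HB.instance Definition _ :=
  Finite_isGroup.Build calG calG_mulA calG_mul1 calG_mulV.

Lemma calG_mulE g h : (g * h)%g = calG_mul g h.
Proof. by []. Qed.

Definition calG_X : {set calG} := [set g | (ypart g == 0) && (tpart g == 0)].
Definition calG_Y : {set calG} := [set g | (xpart g == 0) && (tpart g == 0)].

Lemma calG_X_group_set : group_set calG_X.
Proof.
apply/group_setP; split; first by rewrite inE !eqxx.
move=> g h; rewrite !inE => /andP[/eqP yg /eqP Ag] /andP[/eqP yh /eqP Ah].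
by rewrite calG_mulE /= yg yh Ag Ah linear0r !addr0 !eqxx.
Qed.
Canonical calG_X_group := Group calG_X_group_set.

Lemma calG_Y_group_set : group_set calG_Y.
Proof.
apply/group_setP; split; first by rewrite inE !eqxx.
move=> g h; rewrite !inE => /andP[/eqP xg /eqP Ag] /andP[/eqP xh /eqP Ah].
by rewrite calG_mulE /= xg xh Ag Ah linear0l !addr0 !eqxx.
Qed.
Canonical calG_Y_group := Group calG_Y_group_set.

End CalG.

Definition Gamma (X Y : vectType 'F_2) : rel (calG X Y) :=
  C_graph (calG_X_group X Y) (calG_Y_group X Y).

Definition Sigma (X Y : vectType 'F_2) :=
  @Sigma_graph (calG X Y) (calG_X_group X Y) (calG_Y_group X Y).

Arguments Gamma X Y : clear implicits.
Arguments Sigma X Y : clear implicits.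

(* Main.v *)
(* Write a coset Xg of g = (x, y, A) as (y, A) and a coset Yg as (x, A + x (x) y).
   Then Sigma(n) is the bipartite graph in which (y, A) and (x, B) are adjacent
   iff A + B = x (x) y.  Every automorphism permutes the N-orbits {(y, A) : A} and
   {(x, B) : B}, because two vertices of one orbit that differ by a rank-one tensor
   are joined by a nonbacktracking 4-path through every neighbour of the first,
   while (as n >= 2) this never happens for different orbits.  After composing
   with right multiplications and the swap of X and Y, an automorphism fixes
   (0, 0) on both sides, hence has the form (y, A) -> (beta y, F A),
   (x, B) -> (alpha x, F B) with F (A + x (x) y) = F A + alpha x (x) beta y.  So F
   is additive, therefore so are alpha and beta, and the automorphism comes from
   GL(X) x GL(Y).  Hence Aut(Sigma) is generated by the images of G(n) and of
   GL_n(2) wr S_2, the latter acting as Aut(G(n), S); since Aut(Gamma) preserves the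
   cosets (the triangles of Gamma lie in cosets) and acts faithfully on them, the
   two automorphism groups coincide. *)
Require Import Defs.
From HB Require Import structures.
From mathcomp Require Import all_boot all_order all_algebra all_fingroup all_solvable.
Import GRing.Theory.
Local Open Scope group_scope.
Set Implicit Arguments.
Unset Strict Implicit.
Unset Printing Implicit Defensive.

(** * Linear algebra over F_2 *)
Section CharTwo.
Local Open Scope ring_scope.

Lemma addff (V : lmodType 'F_2) (x : V) : x + x = 0.
Proof.
rewrite -mulr2n -scaler_nat (_ : 2%:R = 0 :> 'F_2) ?scale0r //.
by apply/eqP.
Qed.

Lemma oppf (V : lmodType 'F_2) (x : V) : - x = x.
Proof. by apply/eqP; rewrite eq_sym -addr_eq0 addff. Qed.

Lemma addfK (V : lmodType 'F_2) (x y : V) : x + y + y = x.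
Proof. by rewrite -addrA addff addr0. Qed.

Lemma addf_eq0_eq (V : lmodType 'F_2) (x y : V) : x + y = 0 -> x = y.
Proof. by move/eqP; rewrite addr_eq0 oppf => /eqP. Qed.

Lemma F2_cases (a : 'F_2) : a = 0 \/ a = 1.
Proof. by case: a => [[|[|//]]] i; [left|right]; apply/val_inj. Qed.

(** Matrix units are pure tensors and a scalar can be absorbed into one factor, so every matrix is a
    finite sum of terms [w^T *m v]. Additive statements on the tensor product are reduced to pure
    tensors this way. *)
Lemma tensor_ind m n (P : 'M['F_2]_(m, n) -> Prop) :
    P 0 -> (forall A (w : 'rV_m) (v : 'rV_n), P A -> P (A + w^T *m v)) -> forall A, P A.
Proof.
move=> P0 Padd A; rewrite (matrix_sum_delta A) pair_bigA /=.
elim/big_rec: _ => // ij B _ PB; rewrite addrC.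
have -> : A ij.1 ij.2 *: delta_mx ij.1 ij.2 =
    (A ij.1 ij.2 *: delta_mx 0 ij.1 : 'rV_m)^T *m (delta_mx 0 ij.2 : 'rV_n).
  by rewrite linearZ /= trmx_delta -scalemxAl mul_delta_mx.
exact: Padd.
Qed.

Lemma mul_trmx_inj m n (w : 'rV['F_2]_m) (u v : 'rV['F_2]_n) :
  w != 0 -> w^T *m u = w^T *m v -> u = v.
Proof.
move=> /rV0Pn[i wi] /matrixP/(_ i) E; apply/rowP=> j.
by move: (E j); rewrite !mxE !big_ord1 !mxE; apply: mulfI.
Qed.

(** The map given by [a^T] goes to a line, so it has a nonzero kernel in dimension at least 2. The
    bound n >= 2 enters the rigidity argument here. *)
Lemma orthogonal_exists n (a : 'rV['F_2]_n.+2) :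
  exists2 xi : 'rV['F_2]_n.+2, xi != 0 & xi *m a^T = 0.
Proof.
have : kermx a^T != 0.
  rewrite -mxrank_eq0 mxrank_ker -lt0n subn_gt0 mxrank_tr.
  exact: leq_ltn_trans (rank_leq_row a) _.
case/rowV0Pn=> xi /sub_kermxP E xin0; by exists xi.
Qed.

Lemma dual_exists n (xi : 'rV['F_2]_n) :
  xi != 0 -> exists w : 'rV['F_2]_n, xi *m w^T = 1.
Proof.
move=> /rV0Pn[i xii]; exists (delta_mx 0 i); rewrite trmx_delta.
apply/matrixP=> j k; rewrite !ord1 -colE !mxE.
by case: (F2_cases (xi 0 i)) xii => ->; rewrite ?eqxx.
Qed.

(** The only scalars of F_2 are 0 and 1, so additivity already gives linearity; the rows of the
    matrix are the images of the basis vectors. *)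
Lemma additive_mulmx k l (g : 'rV['F_2]_k -> 'rV['F_2]_l) :
  {morph g : x y / x + y} -> exists N, forall x, g x = x *m N.
Proof.
move=> gD; have g0 : g 0 = 0.
  by apply: (addrI (g 0)); rewrite -gD !addr0.
exists (\matrix_i g (delta_mx 0 i)) => x; rewrite mulmx_sum_row [in LHS](row_sum_delta x).
rewrite (big_morph g gD g0); apply: eq_bigr => i _; rewrite rowK.
by case: (F2_cases (x 0 i)) => ->; rewrite ?scale0r ?scale1r.
Qed.

End CharTwo.

Section MatrixF2.
Local Open Scope ring_scope.

(* Instances at ['F_2] of the generic lemmas, so that all sums and products
   are built on syntactically equal structures. *)
Lemma mx2K m n (A B : 'M['F_2]_(m, n)) : A + B + B = A.
Proof. exact: addfK. Qed.
Lemma mx2D m n (A : 'M['F_2]_(m, n)) : A + A = 0.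
Proof. exact: addff. Qed.
Lemma mx2_eq m n (A B : 'M['F_2]_(m, n)) : A + B = 0 -> A = B.
Proof. exact: addf_eq0_eq. Qed.
Lemma mx2A m n (A B C : 'M['F_2]_(m, n)) : A + (B + C) = A + B + C.
Proof. exact: addrA. Qed.
Lemma mx2AC m n (A B C : 'M['F_2]_(m, n)) : A + B + C = A + C + B.
Proof. exact: addrAC. Qed.
Lemma mx20l m n (A : 'M['F_2]_(m, n)) : 0 + A = A.
Proof. exact: add0r. Qed.
Lemma mx20r m n (A : 'M['F_2]_(m, n)) : A + 0 = A.
Proof. exact: addr0. Qed.
Lemma tr2D m n (A B : 'M['F_2]_(m, n)) : (A + B)^T = A^T + B^T.
Proof. exact: linearD. Qed.
Lemma tr20 m n : (0 : 'M['F_2]_(m, n))^T = 0.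
Proof. exact: trmx0. Qed.
Lemma tr2M m n p (A : 'M['F_2]_(m, n)) (B : 'M_(n, p)) :
  (A *m B)^T = B^T *m A^T.
Proof. exact: trmx_mul. Qed.
Lemma mul2Dl m n p (A B : 'M['F_2]_(m, n)) (C : 'M_(n, p)) :
  (A + B) *m C = A *m C + B *m C.
Proof. exact: mulmxDl. Qed.
Lemma mul2Dr m n p (A : 'M['F_2]_(m, n)) (B C : 'M_(n, p)) :
  A *m (B + C) = A *m B + A *m C.
Proof. exact: mulmxDr. Qed.
Lemma mul2A m n p q (A : 'M['F_2]_(m, n)) (B : 'M_(n, p)) (C : 'M_(p, q)) :
  A *m (B *m C) = A *m B *m C.
Proof. exact: mulmxA. Qed.
Lemma mul20 m n p (A : 'M['F_2]_(m, n)) : A *m 0 = 0 :> 'M_(m, p).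
Proof. exact: mulmx0. Qed.
Lemma mul02 m n p (A : 'M['F_2]_(m, n)) : 0 *m A = 0 :> 'M_(p, n).
Proof. exact: mul0mx. Qed.
Lemma tr2K m n (A : 'M['F_2]_(m, n)) : A^T^T = A.
Proof. exact: trmxK. Qed.
Definition mx2E := (tr2D, tr20, tr2M, tr2K, mul2Dl, mul2Dr, mul20, mul02,
  mx20l, mx20r, mx2A, mul2A).
End MatrixF2.

(** Given a left-nested sum [r] containing [x], this builds a proof that [r + x] is [r] with that
    summand removed. [mxchar2] then proves an identity by moving everything to one side and
    cancelling equal summands in pairs. *)
Ltac char2_cancel r x :=
  match r with
  | (?r' + x)%R => constr:(mx2K r' x)
  | (?r' + ?y)%R => let p := char2_cancel r' x in
      constr:(etrans (mx2AC r' y x) (f_equal (fun z => (z + y)%R) p))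
  | x => constr:(mx2D x)
  end.
Ltac mxchar2 :=
  rewrite ?mx2E /=; apply: mx2_eq; rewrite ?(mx2A, mx20r) /=;
  repeat (match goal with |- (?r + ?x = _)%R =>
     let p := char2_cancel r x in refine (etrans p _) end;
     rewrite ?mx20l);
  try reflexivity.

(** * Rigidity of Sigma(n) in coordinates *)
Section Model.
Local Open Scope ring_scope.
Variable m : nat.
Notation n := m.+2.
Notation rV := 'rV['F_2]_n.
Notation M := 'M['F_2]_n.
Notation vtx := (bool * (rV * M))%type.
Implicit Types (u q : vtx) (v w x y : rV) (A B : M).

(* [false, (v, A)] stands for a coset of X and [true, (w, B)] for a coset of Y;
   they are adjacent iff A + B^T = w^T v, so that [negb] on the first component
   is an automorphism. *)
Definition neighbor u w : vtx := (~~ u.1, (w, u.2.2^T + u.2.1^T *m w)).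
Definition adj u u' := u' == neighbor u u'.2.1.

Lemma neighborK u w : neighbor (neighbor u w) u.2.1 = u.
Proof.
case: u => [b [v A]]; rewrite /neighbor /= negbK; congr (_, (_, _)).
by mxchar2.
Qed.

Lemma adj_neighbor u w : adj u (neighbor u w).
Proof. by rewrite /adj. Qed.

Lemma adj_sym u u' : adj u u' = adj u' u.
Proof.
by apply/eqP/eqP=> ->; rewrite neighborK.
Qed.

Lemma adjE b c v w A B :
  adj (b, (v, A)) (c, (w, B)) = (b != c) && (A + B^T == w^T *m v).
Proof.
rewrite /adj /neighbor /= !xpair_eqE eqxx /=.
have -> : (c == ~~ b) = (b != c) by case: b c => [] [].
congr (_ && _); apply/eqP/eqP => [->|E]; first by mxchar2.
by apply: trmx_inj; rewrite (_ : B^T = A + w^T *m v); [mxchar2 | rewrite -E; mxchar2].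
Qed.

(** The transposes of successive steps cancel, leaving one pure tensor for each of the vertices [w]
    and [w2] visited on the other side. *)
Lemma neighbor4E b v A w w1 w2 w3 :
  neighbor (neighbor (neighbor (neighbor (b, (v, A)) w) w1) w2) w3 =
  (b, (w3, A + w^T *m (v + w1) + w2^T *m (w1 + w3))).
Proof.
rewrite /neighbor /= !negbK; congr (_, (_, _)); mxchar2.
Qed.

(* A 4-path from u to u' without backtracking through every neighbour of u:
   this holds when the matrix parts of u and u' differ by a rank-one matrix and,
   since n >= 2, forces u and u' to lie in the same G'-orbit.  This is how
   automorphisms are seen to permute the G'-orbits. *)
Definition reroutable u u' : Prop := forall q, adj u q -> exists p1 q1,
  [/\ [/\ adj q p1, adj p1 q1 & adj q1 u'], p1 != u, q1 != q & u' != p1].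

(** Suppose v and v' differ. The path through w = 0 shows that A + A' is a pure tensor with left
    factor [a0], so it is killed by a nonzero [xi] orthogonal to [a0]. Applying [xi] to the path
    through some w with xi w^T = 1 leaves (v + c1) + s (c1 + v') = 0 with s in F_2, so c1 = v or v =
    v', both excluded. *)
Lemma reroutable_class u u' : reroutable u u' -> u'.1 = u.1 /\ u'.2.1 = u.2.1.
Proof.
case: u u' => [b [v A]] [b' [v' A']] H /=.
(* A neighbour of a given vertex is determined by its vector, so the nonbacktracking conditions
   become inequalities between vectors. *)
have {}H w : exists w1 w2, [/\ w1 != v, w2 != w, v' != w1
    & (b', (v', A')) = (b, (v', A + w^T *m (v + w1) + w2^T *m (w1 + v')))].
  have [p1 [q1 [[/eqP E1 /eqP E2 /eqP E3] ne1 ne2 ne3]]] := H _ (adj_neighbor _ w).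
  exists p1.2.1, q1.2.1; split.
  - by apply: contraNneq ne1 => E; rewrite E1 E -[v]/((b, (v, A)).2.1) neighborK.
  - by apply: contraNneq ne2 => E; rewrite E2 E E1 -{2}[w]/((neighbor (b, (v, A)) w).2.1) neighborK.
  - by apply: contraNneq ne3 => E; rewrite E3 /= E E2 neighborK.
  by rewrite -neighbor4E -E1 -E2.
have [c0 [a0 [_ _ _ [-> E0]]]] := H 0; split=> //.
apply/eqP/negPn/negP=> ne.
have [xi xi0 xia] := orthogonal_exists a0.
have [w xiw] := dual_exists xi0.
have [c1 [a1 [c1v _ v'c1 [_ E1]]]] := H w.
have: xi *m (A + A') = 0.
  rewrite E0 trmx0 mul0mx addr0 addrA addff add0r.
  by rewrite mulmxA xia mul0mx.
have -> : A + A' = w^T *m (v + c1) + a1^T *m (c1 + v').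
  by rewrite E1; mxchar2.
rewrite mulmxDr !mulmxA xiw mul1mx [xi *m _]mx11_scalar.
case: (F2_cases ((xi *m a1^T) 0 0)) => ->; rewrite ?mul1mx.
  rewrite -scalemx1 scale0r mul0mx addr0 => /addf_eq0_eq /eqP.
  by rewrite eq_sym (negPf c1v).
rewrite addrA addfK => /addf_eq0_eq /eqP; by rewrite eq_sym (negPf ne).
Qed.

Lemma reroutable_rank1 b v A (a c : rV) : a != 0 -> c != 0 ->
  reroutable (b, (v, A)) (b, (v, A + a^T *m c)).
Proof.
move=> a0 c0 q /eqP ->; set w := q.2.1; clearbody w.
have addn0 (x y : rV) : y != 0 -> x + y != x.
  by move=> y0; rewrite -subr_eq0 addrC addKr.
(* The vectors along the path are v, w, v + c, w + a, v, and the matrix changes by w^T c + (w + a)^T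
   c = a^T c. *)
exists (neighbor (neighbor (b, (v, A)) w) (v + c)).
exists (neighbor (neighbor (neighbor (b, (v, A)) w) (v + c)) (w + a)).
split; first split; try exact: adj_neighbor.
- have -> : A + a^T *m c =
      A + w^T *m (v + (v + c)) + (w + a)^T *m ((v + c) + v) by mxchar2.
  rewrite -neighbor4E.
  exact: adj_neighbor.
- rewrite /neighbor !xpair_eqE /= negb_and; apply/orP; right.
  by rewrite negb_and addn0.
- rewrite /neighbor !xpair_eqE /= negb_and; apply/orP; right.
  by rewrite negb_and addn0.
rewrite /neighbor !xpair_eqE /= negb_and; apply/orP; right.
by rewrite negb_and eq_sym addn0.
Qed.

Variable phi : {perm vtx}.
Hypothesis phi_adj : forall u u', adj (phi u) (phi u') = adj u u'.

Lemma reroutable_phi u u' : reroutable u u' -> reroutable (phi u) (phi u').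
Proof.
move=> H q; rewrite -[q](permKV phi) phi_adj => /H[p1 [q1 [[h1 h2 h3] h4 h5 h6]]].
by exists (phi p1), (phi q1); rewrite !phi_adj !(inj_eq perm_inj).
Qed.

(** Two matrices differ by a sum of pure tensors, each nonzero one being a reroutable step, and
    [phi] preserves reroutability. So [phi] permutes the N-orbits. *)
Lemma phi_class b v A B :
  (phi (b, (v, A))).1 = (phi (b, (v, B))).1 /\
  (phi (b, (v, A))).2.1 = (phi (b, (v, B))).2.1.
Proof.
rewrite -(addKr A B) oppf; move: (A + B) => C; elim/tensor_ind: C => [|C a c [-> ->]].
  by rewrite addr0.
case: (eqVneq a 0) => [->|a0]; first by rewrite trmx0 mul0mx addr0.
case: (eqVneq c 0) => [->|c0]; first by rewrite mulmx0 addr0.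
by rewrite addrA; have [-> ->] := reroutable_class (reroutable_phi (reroutable_rank1 (b := b) (v := v) (A := A + C) a0 c0)).
Qed.

Hypothesis phi0 : forall b, phi (b, (0, 0)) = (b, (0, 0)).

Let beta b v := (phi (b, (v, 0))).2.1.
Let F b A := (phi (b, (0, A))).2.2.

Lemma phi_side b v A : (phi (b, (v, A))).1 = b.
Proof.
have [-> _] := phi_class b v A 0.
have : adj (~~ b, (0, 0)) (b, (v, 0)).
  by rewrite adjE trmx0 addr0 mulmx0 eqxx; case: b.
rewrite -phi_adj phi0; case: (phi (b, (v, 0))) => c [w B].
by rewrite adjE; case: c b => [] [].
Qed.

Lemma phi_pair b v A : phi (b, (v, A)) = (b, (beta b v, (phi (b, (v, A))).2.2)).
Proof.
have := phi_side b v A; have [_] := phi_class b v A 0.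
by rewrite /beta; case: (phi (b, (v, A))) => c [w B] /= <- ->.
Qed.

Let f b v A := (phi (b, (v, A))).2.2.

Lemma f_adj b v A w :
  f b v A + (f (~~ b) w (A^T + v^T *m w))^T = (beta (~~ b) w)^T *m beta b v.
Proof.
have := adj_neighbor (b, (v, A)) w; rewrite -phi_adj /neighbor /= phi_pair [phi (~~ b, _)]phi_pair.
by rewrite adjE => /andP[_ /eqP].
Qed.

Lemma beta0 b : beta b 0 = 0.
Proof. by rewrite /beta phi0. Qed.

Lemma F0 b : F b 0 = 0.
Proof. by rewrite /F phi0. Qed.

(** For fixed A the neighbour with vector 0 is the same for every v, and the adjacency equation with
    it determines the matrix part of the image. *)
Lemma fF b v A : f b v A = F b A.
Proof.
have := f_adj b v A 0; have := f_adj b 0 A 0.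
rewrite !beta0 !mulmx0 !addr0 trmx0 mul0mx => <-.
exact/addIr.
Qed.

Lemma phiE b v A : phi (b, (v, A)) = (b, (beta b v, F b A)).
Proof. by rewrite phi_pair -/(f b v A) fF. Qed.

Lemma F_tr b A : (F (~~ b) A^T)^T = F b A.
Proof.
have := f_adj b 0 A 0; rewrite !fF !beta0 !mx2E.
by move/mx2_eq <-.
Qed.

Lemma F_rank1 b A w v :
  F b (A + w^T *m v) = F b A + (beta (~~ b) w)^T *m beta b v.
Proof.
have := f_adj b v A w; rewrite !fF => <-.
have -> : A^T + v^T *m w = (A + w^T *m v)^T by rewrite !mx2E.
by rewrite F_tr addrA addff add0r.
Qed.

Lemma F_tens b w v : F b (w^T *m v) = (beta (~~ b) w)^T *m beta b v.
Proof. by rewrite -[w^T *m v]add0r F_rank1 F0 add0r. Qed.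

Lemma F_add b A B : F b (A + B) = F b A + F b B.
Proof.
elim/tensor_ind: B => [|B w v IH]; first by rewrite F0 !addr0.
by rewrite addrA !F_rank1 IH addrA.
Qed.

Lemma beta_inj b : injective (beta b).
Proof.
move=> v w E; have: phi (b, (v, 0)) = phi (b, (w, 0)) by rewrite !phiE E.
by move/perm_inj=> [].
Qed.

(** Additivity passes from [F] to [beta] through [F_tens], since the nonzero left factor
    [beta (~~ b) e] cancels. *)
Lemma beta_add b v w : beta b (v + w) = beta b v + beta b w.
Proof.
pose e : rV := delta_mx 0 0.
have e0 : beta (~~ b) e != 0.
  rewrite -(beta0 (~~ b)) (inj_eq (@beta_inj _)); apply/eqP=> /matrixP/(_ 0 0).
  by rewrite !mxE.
by apply: (mul_trmx_inj e0); rewrite -F_tens mulmxDr F_add !F_tens mulmxDr.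
Qed.

Lemma phi_linear : exists2 N : bool -> M, forall b, N b \in unitmx
  & forall b v A, phi (b, (v, A)) = (b, (v *m N b, (N (~~ b))^T *m A *m N b)).
Proof.
have [N0 E0] := additive_mulmx (@beta_add false).
have [N1 E1] := additive_mulmx (@beta_add true).
pose N b := if b then N1 else N0; have E b v : beta b v = v *m N b by case: b.
exists N => [b | b v A].
  rewrite -row_free_unit -kermx_eq0; apply/negPn/negP=> /rowV0Pn[v /sub_kermxP vN].
  by rewrite -(inj_eq (@beta_inj b)) beta0 E vN eqxx.
rewrite phiE E; congr (_, (_, _)).
elim/tensor_ind: A => [|A w y IH]; first by rewrite F0 mulmx0 mul0mx.
by rewrite F_rank1 IH !E; rewrite !mx2E.
Qed.

End Model.

(** * Permutations acting on a family of subsets *)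

Section Blocks.
Variables (T : finType) (F : {set {set T}}).

Lemma block_domP (p : {perm T}) :
  (forall A, A \in F -> p @: A \in F) -> p \in block_dom F.
Proof.
move=> pF; apply/setIP; split; first by rewrite inE.
by rewrite inE; apply/subsetP=> A; rewrite !inE => /pF.
Qed.

Lemma block_perm_meet (p : {perm T}) (A B : block F) : p \in block_dom F ->
  (block_perm F p A :&: block_perm F p B == set0 :> {set T}) =
  (A :&: B == set0 :> {set T}).
Proof.
move=> pF; rewrite !block_permE // -imsetI ?imset_eq0 //.
by move=> x y _ _; apply: perm_inj.
Qed.
End Blocks.

(** * The wreath product of GL_n(2) by S_2 *)
Section WreathGL.
Variable m : nat.
Notation n := m.+2.
Notation rV := 'rV['F_2]_n.
Notation M := 'M['F_2]_n.
Notation W := (wreath {'GL_n['F_2]} 2).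

Definition bidx (b : bool) : 'I_2 := inord b.

Lemma bidxE b : bidx b = b :> nat.
Proof. by rewrite inordK //; case: b. Qed.

Lemma bidx_surj i : exists b, i = bidx b.
Proof.
exists (val i == 1%N); apply: val_inj; rewrite /= bidxE.
by case: i => [[|[|]]].
Qed.

Lemma bidx_inj : injective bidx.
Proof. by move=> b c /(congr1 val); rewrite /= !bidxE; case: b c => [] []. Qed.

Lemma S2_cases (s : 'S_2) : s = 1 \/ s = tperm (bidx false) (bidx true).
Proof.
have [[] Es0] := bidx_surj (s (bidx false)); have [[] Es1] := bidx_surj (s (bidx true)).
- by have /perm_inj/bidx_inj : s (bidx false) = s (bidx true) by rewrite Es0 Es1.
- right; apply/permP=> i; have [[] ->] := bidx_surj i; first by rewrite tpermR.
  by rewrite tpermL.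
- left; apply/permP=> i; rewrite perm1; by have [[] ->] := bidx_surj i.
by have /perm_inj/bidx_inj : s (bidx false) = s (bidx true) by rewrite Es0 Es1.
Qed.

Lemma bidx_perm (s : 'S_2) b : s (bidx b) = bidx (b (+) odd_perm s).
Proof.
case: (S2_cases s) => ->; first by rewrite perm1 odd_perm1 addbF.
by rewrite odd_tperm (inj_eq bidx_inj) addbT; case: b; rewrite ?tpermL ?tpermR.
Qed.

(** This records whether the two sides are exchanged. In the action on the group below, [wmx w b] is
    the matrix applied to vectors arriving at side [b]. *)
Definition wswap (w : W) : bool := odd_perm (pair_of_sd w).1.
Definition wmx (w : W) (b : bool) : M :=
  GLval ((pair_of_sd w).2 (bidx b)).

Lemma wswapM w w' : wswap (w * w') = wswap w (+) wswap w'.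
Proof. by rewrite /wswap /= odd_permM. Qed.

Lemma wmxM w w' b :
  wmx (w * w') b = (wmx w (b (+) wswap w') *m wmx w' b)%R.
Proof.
by rewrite /wmx /= dffunM ffunE /= bidx_perm odd_permV.
Qed.

Lemma wmx_unit w b : wmx w b \in unitmx.
Proof. exact: (@GL_unitmx n _ ((pair_of_sd w).2 (bidx b))). Qed.

Lemma wreath_eq1 w : wswap w = false -> (forall b, wmx w b = 1%:M%R) -> w = 1.
Proof.
move=> s0 N1; apply: val_inj; case: w s0 N1 => [[s f] wP]; rewrite /wswap /wmx /= => s0 N1; congr (_, _).
  by case: (S2_cases s) s0 => // ->; rewrite odd_tperm (inj_eq bidx_inj).
apply/ffunP=> i; have [b ->] := bidx_surj i; apply: val_inj.
by apply: etrans (N1 b) _; rewrite ffunE.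
Qed.

Lemma wreath_exists (s : bool) (N : bool -> M) : (forall b, N b \in unitmx) ->
  exists2 w : W, wswap w = s & forall b, wmx w b = N b.
Proof.
move=> uN.
pose g b : {'GL_n['F_2]} := FinRing.Unit (uN b : (N b : 'M_n.-1.+1) \is a GRing.unit).
pose f : power_group {'GL_n['F_2]} 2 := [ffun i : 'I_2 => g (val i == 1%N)].
pose p : 'S_2 := if s then tperm (bidx false) (bidx true) else 1.
have wP : (p, f) \in setX [set: 'S_2] [set: power_group {'GL_n['F_2]} 2] by rewrite !inE.
exists (SdPair (wreath_groupAction {'GL_n['F_2]} 2) wP).
  by rewrite /wswap /= /p; case: (s); rewrite ?odd_perm1 // odd_tperm (inj_eq bidx_inj).
move=> b; have E : (val (bidx b) == 1%N) = b by rewrite /= bidxE; case: b.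
by rewrite /wmx /= ffunE E.
Qed.

End WreathGL.

(** * Automorphisms of Gamma and Sigma *)
(* [cvec b] and [cmat b] are the coordinates (v, A) of the coset X g (for
   [b = false]) or Y g (for [b = true]): (y, A) for g = (x, y, A) in the first
   case and, so that both cases obey the same formulas, (x, (A + x (x) y)^T) in
   the second.  [cedge u w] is the element of the coset u whose vector on the
   other side is w; group elements are the edges of Sigma. *)
Record coordinates (m : nat) (gT : finGroupType) (GX GY : {group gT}) :=
  Coordinates {
    cvec : bool -> gT -> 'rV['F_2]_m.+2;
    cmat : bool -> gT -> 'M['F_2]_m.+2;
    cedge : bool * ('rV['F_2]_m.+2 * 'M['F_2]_m.+2) -> 'rV['F_2]_m.+2 -> gT;
    cvecM : forall b g h, cvec b (g * h) = (cvec b g + cvec b h)%R;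
    cmatM : forall b g h, cmat b (g * h) =
      (cmat b g + cmat b h + (cvec (~~ b) h)^T *m cvec b g)%R;
    cmatN : forall b g,
      cmat (~~ b) g = ((cmat b g)^T + (cvec b g)^T *m cvec (~~ b) g)%R;
    cvec_edge : forall u w, cvec u.1 (cedge u w) = u.2.1;
    cmat_edge : forall u w, cmat u.1 (cedge u w) = u.2.2;
    cvec_edgeN : forall u w, cvec (~~ u.1) (cedge u w) = w;
    coord_inj : forall g h,
      (forall b, cvec b g = cvec b h /\ cmat b g = cmat b h) -> g = h;
    mem_coset_group : forall b g, (g \in (if b then GY else GX)) =
      (cvec b g == 0%R) && (cmat b g == 0%R)
  }.

Section Coordinatized.
Variable m : nat.
Notation n := m.+2.
Notation rV := 'rV['F_2]_n.
Notation M := 'M['F_2]_n.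
Notation vtx := (bool * (rV * M))%type.
Notation W := (wreath {'GL_n['F_2]} 2).

Variables (gT : finGroupType) (GX GY : {group gT}) (co : coordinates m GX GY).

Local Notation pc := (cvec co).
Local Notation pd := (cmat co).
Local Notation edge := (cedge co).

(** * Cosets as vertices of the coordinate model *)

Definition coord b g : vtx := (b, (pc b g, pd b g)).
Definition side b : {group gT} := if b then GY else GX.
Local Notation pcM := (cvecM co).
Local Notation pdM := (cmatM co).
Local Notation pdN := (cmatN co).
Local Notation pc_edge := (cvec_edgeN co).

Lemma coord_edge u w : coord u.1 (edge u w) = u.
Proof. by case: u => b [v A]; rewrite /coord cvec_edge cmat_edge. Qed.
Lemma coord_ext g h : (forall b, coord b g = coord b h) -> g = h.
Proof. by move=> E; apply: (coord_inj (c := co)) => b; have [-> ->] := E b. Qed.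
Lemma mem_side b g : (g \in side b) = (coord b g == (b, (0, 0))%R).
Proof.
by rewrite /coord !xpair_eqE eqxx -(mem_coset_group co); case: b.
Qed.

Lemma pc1 b : pc b 1 = 0%R.
Proof. by apply: (addrI (pc b 1)); rewrite -pcM mulg1 addr0. Qed.

Lemma pd1 b : pd b 1 = 0%R.
Proof.
apply: (addrI (pd b 1)); have := pdM b 1 1.
by rewrite mulg1 !pc1 mulmx0 !addr0 => <-.
Qed.

Lemma coord1 b : coord b 1 = (b, (0, 0))%R.
Proof. by rewrite /coord pc1 pd1. Qed.

Lemma pcV b g : pc b g^-1 = pc b g.
Proof.
by apply: (addIr (pc b g)); rewrite -pcM mulVg pc1 addff.
Qed.

Lemma coordN b g : coord (~~ b) g = neighbor (coord b g) (pc (~~ b) g).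
Proof. by rewrite /coord /neighbor /= pdN. Qed.

Lemma coord_edgeN u w : coord (~~ u.1) (edge u w) = neighbor u w.
Proof. by rewrite coordN coord_edge pc_edge. Qed.

Lemma coord_adj b g : adj (coord b g) (coord (~~ b) g).
Proof. by rewrite coordN adj_neighbor. Qed.

(** An element is the edge joining its X-coset to its Y-coset, and an edge is determined by one end
    and the vector of the other. *)
Lemma eq_elt b g h : coord b g = coord b h -> pc (~~ b) g = pc (~~ b) h -> g = h.
Proof.
move=> E Ec; apply: coord_ext => c; case: (eqVneq c b) => [-> //|].
move=> cb; have -> : c = ~~ b by case: c b cb {E Ec} => [] [].
by rewrite !coordN E Ec.
Qed.

Lemma coord_mul_side b k h : k \in side b -> coord b (k * h) = coord b h.
Proof.
rewrite mem_side /coord !xpair_eqE eqxx /= => /andP[/eqP c0 /eqP d0].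
by rewrite pcM pdM c0 d0 mulmx0 addr0 !add0r.
Qed.

Lemma mem_rcoset_side b g h : (h \in side b :* g) = (coord b h == coord b g).
Proof.
apply/rcosetP/eqP => [[k kb ->]|E]; first exact: coord_mul_side.
exists (h * g^-1); last by rewrite mulgKV.
have Ec : pc b (h * g^-1) = 0%R by rewrite pcM pcV (congr1 (fun u => u.2.1) E : pc b h = _) addff.
have := congr1 (fun u => u.2.2) E; rewrite /= -{1}(mulgKV g h) pdM Ec mulmx0 addr0.
rewrite -[RHS]add0r => /addIr Ed.
by rewrite mem_side /coord Ec Ed.
Qed.

Lemma rcoset_side_eq b c g h :
  (side b :* g == side c :* h) = (coord b g == coord c h).
Proof.
case: (eqVneq b c) => [<-|bc].
  by rewrite -mem_rcoset_side; apply/eqP/rcoset_eqP.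
rewrite /coord !xpair_eqE (negPf bc) /=; apply/negbTE/negP=> /eqP E.
have cb : c = ~~ b by case: b c bc {E} => [] [].
(* Multiplying by this nontrivial element of [side b] changes the vector on the other side, whereas
   equality of the two cosets would put [g] and [k * g] in one coset of [side c]. *)
pose k := edge (b, (0, 0))%R (delta_mx 0 0)%R.
have kb : coord b k = (b, (0, 0))%R by apply: (coord_edge (b, _)).
have : k * g \in side c :* h by rewrite -E mem_rcoset mulgK mem_side kb.
have : g \in side c :* h by rewrite -E rcoset_refl.
rewrite !mem_rcoset_side => /eqP <-; rewrite /coord pcM !xpair_eqE => /and3P[_ /eqP + _].
rewrite -[RHS]add0r => /addIr; rewrite cb (pc_edge (b, _)) => /matrixP/(_ 0%R 0%R).
by rewrite !mxE.
Qed.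

Notation cosetsXY := (cosets GX GY).

Lemma mem_cosets b g : side b :* g \in cosetsXY.
Proof.
rewrite !inE; case: b; apply/orP; [right|left]; apply/rcosetsP; exists g; by rewrite ?inE.
Qed.

Definition cell b g : block cosetsXY := Block (mem_cosets b g).

Lemma cell_eq b c g h : (cell b g == cell c h) = (coord b g == coord c h).
Proof. by rewrite -val_eqE rcoset_side_eq. Qed.

Lemma cell_exists (A : block cosetsXY) : exists bg : bool * gT, A == cell bg.1 bg.2.
Proof.
case: A => S SP; have := SP; rewrite {1}inE => /orP[]/rcosetsP[g _ E].
  by exists (false, g); rewrite -val_eqE /= E.
by exists (true, g); rewrite -val_eqE /= E.
Qed.

Lemma cellP (A : block cosetsXY) : exists b g, A = cell b g.
Proof. by have [[b g] /eqP->] := cell_exists A; exists b, g. Qed.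

(** A block is a bare subset, so a representative is chosen; by [cell_eq] the coordinates do not
    depend on the choice. *)
Definition vcoord (A : block cosetsXY) : vtx :=
  let bg := xchoose (cell_exists A) in coord bg.1 bg.2.

Lemma vcoord_cell b g : vcoord (cell b g) = coord b g.
Proof.
by apply/eqP; rewrite /vcoord -cell_eq eq_sym; apply: (xchooseP (cell_exists (cell b g))).
Qed.

Definition of_vcoord (u : vtx) : block cosetsXY := cell u.1 (edge u 0%R).

Lemma of_vcoordK : cancel of_vcoord vcoord.
Proof. by move=> u; rewrite vcoord_cell coord_edge. Qed.

Lemma of_vcoord_coord b g : of_vcoord (coord b g) = cell b g.
Proof. by apply/eqP; rewrite cell_eq (coord_edge (coord b g)). Qed.

Lemma vcoordK : cancel vcoord of_vcoord.
Proof. by move=> A; have [b [g ->]] := cellP A; rewrite vcoord_cell of_vcoord_coord. Qed.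

Lemma card_blocks : #|{: block cosetsXY}| = (2 ^ (n ^ 2 + n + 1))%N.
Proof.
rewrite (bij_eq_card (Bijective vcoordK of_vcoordK)) !card_prod card_bool !card_mx card_Fp //.
by rewrite mul1n -expnD -expnS; congr (2 ^ _)%N; rewrite -mulnn addn1 addnC.
Qed.

Lemma of_vcoord_inj : injective of_vcoord. Proof. exact: can_inj of_vcoordK. Qed.
Lemma vcoord_inj : injective vcoord. Proof. exact: can_inj vcoordK. Qed.

Notation SigmaG := (Sigma_graph GX GY).
Notation GammaG := (C_graph GX GY).

Lemma Sigma_adj A B : SigmaG A B = adj (vcoord A) (vcoord B).
Proof.
have [b [g ->]] := cellP A; have [c [h ->]] := cellP B; rewrite !vcoord_cell.
have inX d k : (side d :* k \in rcosets GX [set: gT]) = ~~ d.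
  apply/rcosetsP/idP => [[l _]|/negPf ->]; last by exists k; rewrite ?inE.
  by move/eqP; rewrite (rcoset_side_eq d false) => /eqP[->].
have inY d k : (side d :* k \in rcosets GY [set: gT]) = d.
  apply/rcosetsP/idP => [[l _]|->]; last by exists k; rewrite ?inE.
  by move/eqP; rewrite (rcoset_side_eq d true) => /eqP[->].
rewrite /Sigma_graph /= !inX !inY.
have -> : ~~ b && c || b && ~~ c = (c == ~~ b) by case: b c => [] [].
case: eqP => [->|ne] /=; last first.
  by apply/esym/negbTE/negP => /eqP[/ne].
apply/set0Pn/eqP => [[k /setIP[]]|E].
  by rewrite !mem_rcoset_side => /eqP<- /eqP<-; rewrite coordN.
(* The common element is the edge leaving the coset of [g] towards the vector of [h]. *)
exists (edge (coord b g) (pc (~~ b) h)); rewrite inE !mem_rcoset_side (coord_edge (coord b g)) eqxx /=.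
by rewrite (coord_edgeN (coord b g)) E.
Qed.

(** Distinct cosets of the same subgroup are disjoint, so meeting already forces opposite sides. In
    this form adjacency is visibly preserved by every permutation of the group that permutes the
    cosets. *)
Lemma Sigma_meet A B :
  SigmaG A B = (A != B) && (A :&: B != set0 :> {set gT}).
Proof.
apply/idP/andP => [AB|[AB]]; last first.
  have [b [g EA]] := cellP A; have [c [h EB]] := cellP B.
  case/set0Pn=> k /setIP[]; rewrite Sigma_adj EA EB !vcoord_cell /= !mem_rcoset_side.
  move=> /eqP Eb /eqP Ec; rewrite -Eb -Ec; case: (eqVneq c (~~ b)) => [->|cb].
    exact: coord_adj.
  have cb' : c = b by case: b c cb {EA EB Eb Ec} => [] [].
  by move: AB; rewrite EA EB cell_eq -Eb -Ec cb' eqxx.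
split; last by case/andP: AB.
by apply: contraTneq AB => ->; rewrite Sigma_adj /adj /neighbor; case: (vcoord B) => c u; rewrite xpair_eqE; case: c.
Qed.

Lemma Sigma_cell b g : SigmaG (cell b g) (cell (~~ b) g).
Proof. by rewrite Sigma_adj !vcoord_cell coord_adj. Qed.

Lemma Sigma_sym : symmetric SigmaG.
Proof. by move=> A B; rewrite !Sigma_adj adj_sym. Qed.

Lemma SigmaP A B : reflect (exists b g, A = cell b g /\ B = cell (~~ b) g) (SigmaG A B).
Proof.
apply: (iffP idP) => [|[b [g [-> ->]]]]; last exact: Sigma_cell.
rewrite Sigma_adj => /eqP E; exists (vcoord A).1, (edge (vcoord A) (vcoord B).2.1).
by split; apply: vcoord_inj; rewrite vcoord_cell ?coord_edge ?coord_edgeN.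
Qed.

(** * Triangles of Gamma and the action of Aut(Gamma) on cosets *)

Lemma GammaE g h :
  GammaG g h = (h != g) && [exists b, h \in side b :* g].
Proof.
rewrite /C_graph /cayley /connection_set !inE -(inj_eq (mulIg g)) mulgKV mul1g.
congr (_ && _); apply/orP/existsP => [[]H|[[] H]].
- by exists false; rewrite mem_rcoset.
- by exists true; rewrite mem_rcoset.
- by right; rewrite mem_rcoset in H.
by left; rewrite mem_rcoset in H.
Qed.

Lemma card_rcoset_side b g : #|side b :* g| = #|{: rV}|.
Proof.
have injf : injective (edge (coord b g)).
  by move=> x y E; rewrite -[x](pc_edge (coord b g)) E pc_edge.
rewrite -(card_imset _ injf); apply: eq_card => h; rewrite mem_rcoset_side.
apply/eqP/imsetP=> [E|[w _ ->]]; last by rewrite (coord_edge (coord b g)).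
exists (pc (~~ b) h) => //; apply: (@eq_elt b).
  by rewrite (coord_edge (coord b g)).
by rewrite (pc_edge (coord b g)).
Qed.

Lemma coord2_inj b c g h : b != c -> coord b g = coord b h -> coord c g = coord c h -> g = h.
Proof.
move=> bc Eb Ec; apply: coord_ext => d.
by case: (eqVneq d b) => [->//|db]; have -> : d = c by case: d b c bc db {Eb Ec} => [] [] [].
Qed.

(** If [k] were outside the coset, both [g] and [h] would be joined to it through the other
    subgroup; they would then share cosets of both subgroups and coincide. *)
Lemma Gamma_triangle b g h k : h \in side b :* g -> h != g ->
  GammaG g k -> GammaG h k -> k \in side b :* g.
Proof.
rewrite mem_rcoset_side => /eqP Ehg hg; rewrite !GammaE.
move=> /andP[_ /existsP[c kg]] /andP[_ /existsP[d kh]].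
case: (eqVneq c b) => [<- //|cb]; rewrite !mem_rcoset_side in kg kh *.
case: (eqVneq d b) kh => [->|db kh]; first by rewrite Ehg.
have dc : d = c by case: d c b cb db {hg Ehg kg kh} => [] [] [].
case/eqP: hg; apply: (coord2_inj cb) => //; by rewrite -(eqP kg) -dc (eqP kh).
Qed.

Lemma autGamma_rcoset p b g : p \in autg GammaG ->
  exists c, p @: (side b :* g) = side c :* p g.
Proof.
(* A second element [k] of the coset: the edge from [p g] to [p k] selects the side [c], and every
   further element of the coset forms a triangle with [g] and [k]. *)
move/autgP=> pP; pose k := edge (b, (0, 0))%R (delta_mx 0 0)%R * g.
have kcell : k \in side b :* g.
  by rewrite mem_rcoset mulgK mem_side (coord_edge (b, _)).
have kg : k != g.
  apply/eqP=> E; have := pc_edge (b, (0, 0))%R (delta_mx 0 0 : rV)%R.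
  have /eqP -> : edge (b, (0, 0))%R (delta_mx 0 0)%R == 1 by rewrite -(inj_eq (mulIg g)) -/k E mul1g.
  by rewrite pc1 => /matrixP/(_ 0%R 0%R); rewrite !mxE.
have : GammaG (p g) (p k) by rewrite pP GammaE kg; apply/existsP; exists b.
rewrite GammaE => /andP[pkg /existsP[c pk]]; exists c.
apply/eqP; rewrite eqEcard card_imset ?card_rcoset_side ?leqnn ?andbT; last exact: perm_inj.
apply/subsetP=> _ /imsetP[h hb ->].
case: (eqVneq h g) => [->|hg]; first by rewrite rcoset_refl.
case: (eqVneq h k) => [->//|hk].
apply: (@Gamma_triangle c _ (p k)) => //; rewrite pP GammaE ?hg ?hk; apply/existsP; exists b => //.
by move: hb kcell; rewrite !mem_rcoset_side => /eqP-> /eqP->.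
Qed.

Lemma autGamma_dom : autg GammaG \subset block_dom cosetsXY.
Proof.
apply/subsetP=> p pA; apply: block_domP => A Ain.
have [b [g EA]] := cellP (Block Ain).
have -> : A = side b :* g by rewrite -[A]/(block_set (Block Ain)) EA.
by have [c ->] := autGamma_rcoset b g pA; apply: mem_cosets.
Qed.

Notation bp := (block_perm cosetsXY).

Lemma block_perm_cell p b c g h : p \in block_dom cosetsXY ->
  p @: (side b :* g) = side c :* h -> bp p (cell b g) = cell c h.
Proof. by move=> pD E; apply: val_inj; rewrite /= block_permE. Qed.

(** An automorphism fixing all blocks preserves both cosets of every element, and these determine
    the element. *)
Lemma block_perm_inj : {in autg GammaG &, injective bp}.
Proof.
have bp1 p : p \in autg GammaG -> bp p = 1 -> p = 1.
  move=> pA Ep; apply/permP=> g; rewrite perm1; apply: coord_ext => b.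
  have [c E] := autGamma_rcoset b g pA.
  have := block_perm_cell (subsetP autGamma_dom p pA) E.
  rewrite Ep perm1 => /eqP; rewrite cell_eq => /eqP Ek.
  by rewrite Ek; move: Ek => [->].
move=> p q pA qA E; apply/eqP; rewrite eq_mulgV1; apply/eqP/bp1.
  by rewrite groupM ?groupV.
have sub := subsetP autGamma_dom.
by rewrite morphM ?groupV ?sub // morphV ?sub // E mulgV.
Qed.

Lemma block_perm_aut p : p \in block_dom cosetsXY -> bp p \in autg SigmaG.
Proof.
move=> pD; apply/autgP=> A B; rewrite !Sigma_meet (inj_eq perm_inj).
by rewrite block_perm_meet.
Qed.

(** * Right multiplications and the wreath product acting on the group *)

Lemma right_regE k g : right_reg gT k g = g * k.
Proof. by rewrite actpermE. Qed.

Lemma right_reg_aut k : right_reg gT k \in autg GammaG.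
Proof.
apply/autgP=> g h; rewrite /C_graph /cayley !right_regE invMg.
by rewrite mulgA mulgK.
Qed.

Lemma right_reg_cell k b g : bp (right_reg gT k) (cell b g) = cell b (g * k).
Proof.
apply: block_perm_cell; first exact: (subsetP autGamma_dom) (right_reg_aut k).
apply/setP=> h; rewrite mem_rcoset.
apply/imsetP/idP => [[l lb ->]|H].
  by rewrite right_regE invMg mulgA mulgK -mem_rcoset.
by exists (h * k^-1); rewrite ?right_regE ?mulgKV // mem_rcoset -mulgA -invMg.
Qed.

Lemma injm_right_reg : 'injm (right_reg gT).
Proof.
apply/subsetP=> g /morphpreP[_] /set1P E.
by rewrite inE -[g]mul1g -right_regE E perm1.
Qed.

(** The image is prescribed by its coset on side [s], to which side [false] is sent, together with
    its vector on the other side. Vectors transform by v -> v N and matrices by A -> N'^T A N, where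
    N and N' are the matrices of the two sides. *)
Definition wact (w : W) (g : gT) : gT :=
  let s := wswap w in
  edge (s, (pc false g *m wmx w s, (wmx w (~~ s))^T *m pd false g *m wmx w s)%R)
       (pc true g *m wmx w (~~ s))%R.

Lemma coord_wact w b g : coord (b (+) wswap w) (wact w g) =
  (b (+) wswap w, (pc b g *m wmx w (b (+) wswap w),
    (wmx w (~~ (b (+) wswap w)))^T *m pd b g *m wmx w (b (+) wswap w))%R).
Proof.
(* Side [false] holds by construction; side [true] follows from the relation [cmatN] between the two
   matrix coordinates. *)
case: b; last exact: (coord_edge (wswap w, _)).
rewrite !addTb (coord_edgeN (wswap w, _)) /neighbor /= negbK.
by rewrite -[pd true g]/(pd (~~ false) g) (pdN false) !mx2E.
Qed.

Lemma pc_wact w b g :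
  pc (b (+) wswap w) (wact w g) = (pc b g *m wmx w (b (+) wswap w))%R.
Proof. by have [] := coord_wact w b g. Qed.
Lemma pd_wact w b g : pd (b (+) wswap w) (wact w g) =
  ((wmx w (~~ (b (+) wswap w)))^T *m pd b g *m wmx w (b (+) wswap w))%R.
Proof. by have [] := coord_wact w b g. Qed.

Lemma addb2K b s : b (+) s (+) s = b.
Proof. by case: b s => [] []. Qed.

Lemma shift_inj s g h : (forall b, coord (b (+) s) g = coord (b (+) s) h) -> g = h.
Proof. by move=> H; apply: coord_ext => b; rewrite -[b](addb2K b s). Qed.

Lemma wactM w w' g : wact (w * w') g = wact w' (wact w g).
Proof.
apply: (@shift_inj (wswap (w * w'))) => b; rewrite coord_wact.
rewrite wswapM addbA coord_wact; congr (_, (_, _)).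
  by rewrite pc_wact wmxM addb2K mulmxA.
by rewrite pd_wact !wmxM !mx2E addNb addb2K.
Qed.

Lemma wact_morph w : {morph wact w : g h / g * h}.
Proof.
move=> g h; apply: (@shift_inj (wswap w)) => b; rewrite coord_wact.
rewrite /coord !pcM !pdM !pc_wact !pd_wact -!addNb pc_wact.
by congr (_, (_, _)); rewrite !mx2E.
Qed.

Lemma wact1 g : wact 1 g = g.
Proof.
apply: coord_ext => b.
have w0 : wswap (1 : W) = false by rewrite /wswap /= odd_perm1.
have := coord_wact 1 b g; rewrite w0 addbF => ->.
have N1 c : wmx (1 : W) c = 1%:M%R by rewrite /wmx /= ffunE.
by rewrite !N1 trmx1 mul1mx !mulmx1.
Qed.

Lemma wactK w : cancel (wact w) (wact w^-1).
Proof. by move=> g; rewrite -wactM mulgV wact1. Qed.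

Definition theta (w : W) : {perm gT} := perm (can_inj (wactK w)).
Lemma thetaE w g : theta w g = wact w g. Proof. exact: permE. Qed.
Lemma thetaM : {in [set: W] &, {morph theta : w w' / w * w'}}.
Proof.
by move=> w w' _ _; apply/permP=> g; rewrite permM !thetaE wactM.
Qed.
Canonical theta_morphism := Morphism thetaM.

Lemma injm_theta : 'injm theta.
Proof.
apply/subsetP=> w /morphpreP[_] /set1P E; rewrite inE; apply/eqP.
have wid g : wact w g = g by rewrite -thetaE E perm1.
have s0 : wswap w = false.
  apply/negbTE/negP => s1.
  (* A nontrivial element of X: exchanging the sides would give its image vector 0 on side [true],
     where its own vector is nonzero. *)
  pose g := edge (false, (0, 0))%R (delta_mx 0 0)%R.
  have := pc_wact w false g; rewrite s1 wid (congr1 (fun u => u.2.1) (coord_edge (false, _) _) : pc false g = _) mul0mx.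
  rewrite (pc_edge (false, _)) => /matrixP/(_ 0%R 0%R); by rewrite !mxE.
apply: wreath_eq1 => // b; apply/row_matrixP=> i.
rewrite !rowE mulmx1.
have := pc_wact w b (edge (b, (delta_mx 0 i, 0))%R 0%R).
rewrite wid s0 addbF (congr1 (fun u => u.2.1) (coord_edge (b, _) _) : pc b (edge _ _) = _).
by move<-.
Qed.

Notation S := (connection_set GX GY).

Lemma theta_Aut w : theta w \in Aut [set: gT].
Proof.
rewrite inE; apply/andP; split; first by apply/subsetP=> g _; rewrite inE.
by apply/morphicP=> g h _ _; rewrite !thetaE wact_morph.
Qed.

Lemma wact_eq1 w : wact w 1 = 1.
Proof. by apply: (mulgI (wact w 1)); rewrite -wact_morph !mulg1. Qed.

Lemma connectionE g : (g \in S) = (g != 1) && [exists b, g \in side b].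
Proof.
rewrite !inE; congr (_ && _); apply/orP/existsP => [[]H|[[] H]].
- by exists false.
- by exists true.
- by right.
by left.
Qed.

Lemma theta_aut_set w : theta w \in aut_set S.
Proof.
rewrite inE theta_Aut eqEcard card_imset ?leqnn ?andbT; last exact: perm_inj.
apply/subsetP=> _ /imsetP[g + ->]; rewrite !connectionE => /andP[g1 /existsP[b gb]].
rewrite thetaE -{1}(wact_eq1 w) (inj_eq (can_inj (wactK w))) g1 /=.
apply/existsP; exists (b (+) wswap w); rewrite mem_side coord_wact.
move: gb; rewrite mem_side /coord !xpair_eqE => /andP[_ /andP[/eqP-> /eqP->]].
by rewrite mul0mx mulmx0 mul0mx !eqxx.
Qed.

Lemma aut_set_Gamma : aut_set S \subset autg GammaG.
Proof.
apply/subsetP=> a; rewrite inE => /andP[aA /eqP aS]; apply/autgP=> g h.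
have aM := morphicP (Aut_morphic aA).
rewrite /C_graph /cayley -[RHS](mem_imset _ _ (@perm_inj _ a)) aS.
rewrite aM ?inE // -[a g^-1](mulKg (a g)) -aM ?inE // mulgV.
suff -> : a 1 = 1 by rewrite mulg1.
by apply: (mulgI (a 1)); rewrite -aM ?inE // !mulg1.
Qed.

Lemma theta_dom w : theta w \in block_dom cosetsXY.
Proof. exact: (subsetP autGamma_dom) (subsetP aut_set_Gamma _ (theta_aut_set w)). Qed.

Lemma theta_cell w b g : bp (theta w) (cell b g) = cell (b (+) wswap w) (wact w g).
Proof.
apply: block_perm_cell; first exact: theta_dom.
apply/eqP; rewrite eqEcard card_imset ?card_rcoset_side ?leqnn ?andbT; last exact: perm_inj.
apply/subsetP=> _ /imsetP[h + ->]; rewrite !mem_rcoset_side thetaE !coord_wact.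
by move/eqP => [-> ->].
Qed.

(** * Determination of Aut(Gamma) and Aut(Sigma) *)

Definition RG : {group {perm gT}} := (right_reg gT @* [set: gT])%G.
Definition TG : {group {perm gT}} := (theta @* [set: W])%G.
Definition KG : {group {perm gT}} := (RG <*> TG)%G.

Lemma right_reg_in k : right_reg gT k \in KG.
Proof. by rewrite mem_gen // inE mem_morphim ?inE. Qed.
Lemma theta_in w : theta w \in KG.
Proof. by rewrite mem_gen // inE orbC mem_morphim ?inE. Qed.

Lemma KG_Gamma : KG \subset autg GammaG.
Proof.
rewrite join_subG; apply/andP; split; apply/subsetP=> _ /morphimP[x _ _ ->].
  exact: right_reg_aut.
exact: subsetP aut_set_Gamma _ (theta_aut_set _).
Qed.

Lemma KG_dom p : p \in KG -> p \in block_dom cosetsXY.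
Proof. move=> pK; exact: (subsetP (subset_trans KG_Gamma autGamma_dom)). Qed.

(** In coordinates [q] is an adjacency-preserving permutation of the model fixing both base
    vertices, so [phi_linear] yields two invertible matrices; these form a wreath element without
    swap. *)
Lemma autSigma_fix q : q \in autg SigmaG -> (forall b, q (cell b 1) = cell b 1) ->
  exists w, q = bp (theta w).
Proof.
move=> /autgP qP q1.
have phi_inj : injective (fun u => vcoord (q (of_vcoord u))).
  by move=> u u' /vcoord_inj/perm_inj/of_vcoord_inj.
pose phi : {perm vtx} := perm phi_inj.
have phi_adj u u' : adj (phi u) (phi u') = adj u u'.
  by rewrite !permE -Sigma_adj qP Sigma_adj !of_vcoordK.
have phi0 b : phi (b, (0, 0))%R = (b, (0, 0))%R.
  by rewrite permE -(coord1 b) of_vcoord_coord q1 vcoord_cell.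
have [N uN EN] := phi_linear phi_adj phi0.
have [w w0 wN] := wreath_exists false uN; exists w.
apply/permP=> A; have [b [g ->]] := cellP A; rewrite theta_cell w0 addbF.
apply: vcoord_inj; rewrite vcoord_cell -of_vcoord_coord.
have := EN b (pc b g) (pd b g); rewrite permE => ->.
by have := coord_wact w b g; rewrite w0 addbF !wN.
Qed.

(** The base edge goes to the edge of some [k], possibly with its ends exchanged. Composing with the
    translation by [k^-1] and a suitable swap reduces to [autSigma_fix]. *)
Lemma autSigma_sub : autg SigmaG \subset bp @* KG.
Proof.
apply/subsetP=> q qA.
have: SigmaG (q (cell false 1)) (q (cell true 1)).
  by rewrite (autgP _ _ qA) (Sigma_cell false).
case/SigmaP=> s [k [E0 E1]].
have [w0 w0s _] := @wreath_exists m s (fun=> 1%:M%R) (fun=> unitmx1 _ _).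
pose r := right_reg gT k^-1 * theta w0.
have rK : r \in KG by rewrite groupM ?right_reg_in ?theta_in.
have qr : q * bp r \in autg SigmaG by rewrite groupM // block_perm_aut // KG_dom.
have [b|w Ew] := autSigma_fix qr.
  rewrite permM morphM ?KG_dom ?right_reg_in ?theta_in // permM.
  have -> : q (cell b 1) = cell (b (+) s) k by case: b; rewrite ?E0 ?E1 ?addTb.
  by rewrite right_reg_cell theta_cell mulgV wact_eq1 w0s addb2K.
have -> : q = bp (theta w * r^-1).
  by rewrite morphM ?morphV ?groupV ?KG_dom ?theta_in // -Ew mulgK.
by rewrite mem_morphim ?KG_dom // groupM ?groupV ?theta_in.
Qed.

(** [block_perm] sends Aut(Gamma) into Aut(Sigma), which lies in the image of [KG]; injectivity on
    Aut(Gamma) pulls the inclusion back. *)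
Lemma autGammaE : autg GammaG = KG.
Proof.
apply/eqP; rewrite eqEsubset KG_Gamma andbT; apply/subsetP=> p pA.
have := subsetP autSigma_sub _ (block_perm_aut (subsetP autGamma_dom _ pA)).
case/morphimP=> r _ rK /(block_perm_inj pA (subsetP KG_Gamma _ rK)) E; by rewrite E.
Qed.

Lemma autSigmaE : autg SigmaG = bp @* KG.
Proof.
apply/eqP; rewrite eqEsubset autSigma_sub; apply/subsetP=> _ /morphimP[r rD _ ->].
exact: block_perm_aut.
Qed.

Lemma right_reg_conj k w :
  right_reg gT k ^ theta w = right_reg gT (wact w k).
Proof.
apply/permP=> g; rewrite /conjg !permM -morphV ?inE // !thetaE !right_regE.
by rewrite wact_morph -wactM mulVg wact1.
Qed.

Lemma RG_norm : TG \subset 'N(RG).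
Proof.
apply/subsetP=> _ /morphimP[w _ _ ->]; rewrite inE; apply/subsetP=> _ /imsetP[_ /morphimP[k _ _ ->] ->].
by rewrite right_reg_conj mem_morphim ?inE.
Qed.

Lemma KG_mul : KG = RG * TG :> {set _}.
Proof. by rewrite /= norm_joinEr // RG_norm. Qed.

Lemma KGP p : p \in KG -> exists k w, p = right_reg gT k * theta w.
Proof.
by rewrite KG_mul => /mulsgP[_ _ /morphimP[k _ _ ->] /morphimP[w _ _ ->] ->]; exists k, w.
Qed.

Lemma aut_set_fix1 a : a \in aut_set S -> a 1 = 1.
Proof.
rewrite inE => /andP[aA _]; have aM := morphicP (Aut_morphic aA).
by apply: (mulgI (a 1)); rewrite -aM ?inE // !mulg1.
Qed.

(** A group automorphism fixes 1, which forces the translation in its factorization from [KGP] to be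
    trivial. *)
Lemma aut_set_theta : aut_set S = TG.
Proof.
apply/eqP; rewrite eqEsubset; apply/andP; split; last first.
  by apply/subsetP=> _ /morphimP[w _ _ ->]; apply: theta_aut_set.
apply/subsetP=> a aA; have := subsetP aut_set_Gamma a aA; rewrite autGammaE.
case/KGP=> k [w E]; have := aut_set_fix1 aA.
rewrite E permM right_regE mul1g thetaE -(wact_eq1 w) => /(can_inj (wactK w)) ->.
by rewrite morph1 mul1g mem_morphim ?inE.
Qed.

Lemma RT_triv : RG :&: TG = 1.
Proof.
apply/trivgP/subsetP=> p /setIP[/morphimP[k _ _ ->]]; rewrite -aut_set_theta.
move/aut_set_fix1; rewrite right_regE mul1g => ->.
by rewrite morph1 inE.
Qed.

Lemma autGamma_sdprod : right_reg gT @* [set: gT] ><| aut_set S = autg GammaG.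
Proof.
by rewrite aut_set_theta autGammaE KG_mul sdprodE ?RG_norm // RT_triv.
Qed.

Lemma aut_set_isog : aut_set S \isog [set: W].
Proof.
rewrite aut_set_theta isog_sym; apply: sub_isog => //; exact: injm_theta.
Qed.

Lemma wact_is_action : is_action [set: W] (fun g w => wact w g).
Proof.
by apply: is_total_action => [g|g w w']; rewrite ?wact1 ?wactM.
Qed.
Definition wact_action := Action wact_is_action.
Lemma wact_is_groupAction : is_groupAction [set: gT] wact_action.
Proof.
move=> w _; rewrite inE; apply/andP; split; first by apply/subsetP=> g _; rewrite inE.
by apply/morphicP=> g h _ _; rewrite !actpermE /= wact_morph.
Qed.
Definition wact_groupAction := GroupAction wact_is_groupAction.

Lemma autGamma_isog : isog_semidirect (autg_group GammaG) [set: gT]%G [set: W]%G.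
Proof.
exists wact_groupAction.
have actf : {in [set: gT] & [set: W],
    morph_act wact_groupAction 'J (right_reg gT) theta}.
  by move=> k w _ _; rewrite /= right_reg_conj.
rewrite /= autGammaE isog_sym.
have <- : xsdprodm actf @* setT = KG by rewrite im_xsdprodm KG_mul.
apply: sub_isog => //; rewrite injm_xsdprodm injm_right_reg injm_theta.
by apply/eqP; exact: RT_triv.
Qed.

Lemma block_perm_misom : misom (autg_group GammaG) (autg_group SigmaG) bp.
Proof.
have fM : morphic (autg_group GammaG) bp.
  by apply/morphicP=> p q pA qA; rewrite morphM ?(subsetP autGamma_dom).
apply/misomP; exists fM; apply/isomP; split.
  by apply/injmP => p q pA qA /=; apply: block_perm_inj.
rewrite /= morphimEdom autSigmaE morphimEsub; last by rewrite -autGammaE autGamma_dom.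
by rewrite -autGammaE.
Qed.

(** * The quotient by the derived subgroup *)
Definition psi (g : gT) : rV * rV := (pc true g, pc false g).
Lemma psiM : {in [set: gT] &, {morph psi : g h / g * h}}.
Proof. by move=> g h _ _; rewrite /psi !pcM. Qed.
Canonical psi_morphism := Morphism psiM.

Lemma ker_psiP z : reflect (forall b, pc b z = 0%R) (z \in 'ker psi).
Proof.
apply: (iffP idP) => [/morphpreP[_ /set1P[z1 z0]] [] //|z0].
by apply/kerP; rewrite ?inE //= /psi !z0.
Qed.

(** Elements with both vectors zero make up the derived subgroup ([der_ker]), while [xelt] and
    [yelt] parametrize X and Y. *)
Definition zelt A := edge (false, (0, A))%R 0%R.
Definition xelt w := edge (false, (0, 0))%R w.
Definition yelt v := edge (false, (v, 0))%R 0%R.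

Lemma pc_edgeE b v A w : pc b (edge (b, (v, A)) w) = v.
Proof. by have [] := coord_edge (b, (v, A)) w. Qed.
Lemma pd_edgeE b v A w : pd b (edge (b, (v, A)) w) = A.
Proof. by have [] := coord_edge (b, (v, A)) w. Qed.
Lemma pc_edgeF v A w : pc true (edge (false, (v, A)) w) = w.
Proof. exact: (pc_edge (false, (v, A))). Qed.

Lemma xelt_side w : xelt w \in side false.
Proof. by rewrite mem_side (coord_edge (false, _)). Qed.

Lemma yelt_side v : yelt v \in side true.
Proof. by rewrite mem_side (coord_edgeN (false, _)) /neighbor /= trmx0 mulmx0 addr0. Qed.

(** Commutators between Y and X are pure tensors, so they produce all of the tensor product. The
    inverses are placed so that multiplying by [xelt w * yelt v] clears every inverse. *)
Lemma zelt_step A w v :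
  zelt (A + w^T *m v)%R = zelt A * [~ (yelt v)^-1, (xelt w)^-1].
Proof.
rewrite commgEl conjgE !invgK !mulgA; apply: (mulIg (xelt w * yelt v)).
rewrite !mulgA mulgKV mulgKV.
apply: (@eq_elt false); last by rewrite !pcM !pc_edgeF !addr0 !add0r.
rewrite /coord !pdM !pcM !pc_edgeE !pd_edgeE !pc_edgeF.
by congr (_, (_, _)); rewrite !mx2E.
Qed.

Lemma elt_decomp g :
  g = zelt (pd false g) * (xelt (pc true g) * yelt (pc false g)).
Proof.
apply: (@eq_elt false); last by rewrite !pcM !pc_edgeF addr0 add0r.
rewrite /coord !pdM !pcM !pc_edgeE !pd_edgeE !pc_edgeF.
by congr (_, (_, _)); rewrite !mx2E.
Qed.

Lemma zelt1 : zelt 0%R = 1.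
Proof.
apply: (@eq_elt false); last by rewrite pc_edgeF pc1.
by rewrite coord1 (coord_edge (false, _)).
Qed.

Lemma sides_generate (H : {group gT}) : (forall b, side b \subset H) -> H = [set: gT]%G.
Proof.
move=> sH; apply/val_inj/setP=> g; rewrite inE /=.
have xH w : xelt w \in H by apply: (subsetP (sH false)); apply: xelt_side.
have yH v : yelt v \in H by apply: (subsetP (sH true)); apply: yelt_side.
rewrite (elt_decomp g) groupM ?groupM //.
elim/tensor_ind: (pd false g) => [|A w v AH]; first by rewrite zelt1 group1.
by rewrite zelt_step groupM // groupR ?groupV.
Qed.

Notation G := ([set: gT]%G : {group gT}).

Lemma der_ker : G^`(1) = 'ker psi.
Proof.
apply/eqP; rewrite eqEsubset; apply/andP; split.
  rewrite derg1 gen_subG; apply/subsetP=> _ /imset2P[g h _ _ ->].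
  apply/ker_psiP=> b.
  by rewrite commgEl conjgE !pcM !pcV; mxchar2.
apply/subsetP=> z /ker_psiP z0; have -> : z = zelt (pd false z).
  apply: (@eq_elt false); last by rewrite pc_edgeF z0.
  by rewrite (coord_edge (false, _)) /coord z0.
elim/tensor_ind: (pd false z) => [|A w v AH]; first by rewrite zelt1 group1.
by rewrite zelt_step groupM //; exact: (mem_commg (in_setT _) (in_setT _)).
Qed.

(** * Connectedness of Gamma and Sigma *)

Lemma autg_connect (V : finType) (e : rel V) p u v :
  p \in autg e -> connect e u v -> connect e (p u) (p v).
Proof.
move/autgP=> pe /connectP[s es ->]; elim: s u es => //= x s IH u /andP[ux xs].
by apply: connect_trans (IH _ xs); apply: connect1; rewrite pe.
Qed.

(** The elements keeping [u] in its component form a subgroup; it contains both sides, so it is the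
    whole group by [sides_generate]. *)
Lemma connect_orbit (V : finType) (e : rel V) (rho : gT -> {perm V}) (u : V) :
    (forall g, rho g \in autg e) ->
    (forall g h, rho (g * h) u = rho h (rho g u)) -> rho 1 u = u ->
    (forall b g, g \in side b -> connect e u (rho g u)) ->
  forall g, connect e u (rho g u).
Proof.
move=> rA rM r1 rS.
have Hgrp : group_set [set g | connect e u (rho g u)].
  apply/group_setP; split; first by rewrite inE r1.
  move=> g h; rewrite !inE rM => cg ch.
  exact: connect_trans ch (autg_connect (rA h) cg).
have HG : Group Hgrp = G.
  by apply: sides_generate => b; apply/subsetP=> g gb; rewrite inE; apply: rS gb.
move=> g; have : g \in Group Hgrp by rewrite HG inE.
by rewrite inE.
Qed.

Lemma Gamma_is_graph : is_graph GammaG.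
Proof.
have sym : symmetric GammaG.
  move=> g h; rewrite !GammaE eq_sym; congr (_ && _).
  by apply: eq_existsb => b; rewrite !mem_rcoset_side eq_sym.
split=> [||g h]; first exact: sym.
  by move=> g; rewrite GammaE eqxx.
have c1 k : connect GammaG 1 k.
  rewrite -[k]mul1g -right_regE.
  apply: (connect_orbit right_reg_aut) => [x y||b x xb]; rewrite !right_regE ?mulgA ?mulg1 // mul1g.
  case: (eqVneq x 1) => [->|x1]; first exact: connect0.
  by apply: connect1; rewrite GammaE x1; apply/existsP; exists b; rewrite mem_rcoset invg1 mulg1.
by apply: connect_trans (c1 h); rewrite (sym_connect_sym sym).
Qed.

Lemma right_reg_Sigma k : bp (right_reg gT k) \in autg SigmaG.
Proof. by apply: block_perm_aut; apply: KG_dom; apply: right_reg_in. Qed.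
Lemma theta_Sigma w : bp (theta w) \in autg SigmaG.
Proof. by apply: block_perm_aut; apply: KG_dom; apply: theta_in. Qed.

Lemma Sigma_is_graph : is_graph SigmaG.
Proof.
split; first exact: Sigma_sym; first by move=> A; rewrite Sigma_meet eqxx.
have csym := sym_connect_sym Sigma_sym.
have c1 k : connect SigmaG (cell false 1) (cell false k).
  have -> : cell false k = bp (right_reg gT k) (cell false 1) by rewrite right_reg_cell mul1g.
  apply: (connect_orbit right_reg_Sigma) => [x y||b x];
    rewrite !right_reg_cell ?mulgA ?mulg1 // mul1g.
  case: b => xb.
    apply: connect_trans (connect1 (Sigma_cell false 1)) _.
    (* Since [x] lies in Y, the cosets X and Xx are both adjacent to Y = Yx. *)
    have -> : cell (~~ false) 1 = cell true x.
      by apply/eqP; rewrite cell_eq -mem_rcoset_side /= mem_rcoset mul1g groupV.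
    by apply: connect1; exact: (Sigma_cell true).
  suff -> : cell false x = cell false 1 by exact: connect0.
  by apply/eqP; rewrite cell_eq -mem_rcoset_side mem_rcoset invg1 mulg1.
have c2 A : connect SigmaG (cell false 1) A.
  have [[] [g ->]] := cellP A; last exact: c1.
  exact: connect_trans (c1 g) (connect1 (Sigma_cell false g)).
by move=> A B; apply: connect_trans (c2 B); rewrite csym.
Qed.

(** * Transitivity on 2-arcs *)

Lemma row_transitive (v : rV) : v != 0%R ->
  exists2 N : M, N \in unitmx & (v *m N = delta_mx 0 0)%R.
Proof.
move=> v0; exists (invmx (row_ebase v)); first by rewrite unitmx_inv row_ebase_unit.
have rk : \rank v = 1%N by rewrite rank_rV v0.
(* In the rank factorization of a row the column factor is an invertible scalar, which over F_2 is
   1. *)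
have E : col_ebase v = 1%:M%R.
  have := col_ebase_unit v; rewrite [col_ebase v]mx11_scalar unitmxE det_scalar1.
  by case: (F2_cases (col_ebase v 0 0)%R) => ->; rewrite ?unitr0.
rewrite -{1}(mulmx_ebase v) rk E mul1mx -mulmxA mulmxV ?row_ebase_unit // mulmx1.
by apply/matrixP=> i j; rewrite !ord1 !mxE /= eq_sym andbC; case: j => [[|j] ?].
Qed.

(** A translation and a swap bring the first edge to (X, Y). The third vertex is then Xh with h
    nontrivial in Y, and a matrix acting on that side alone moves the vector of h to the first basis
    vector. *)
Lemma two_arc_std A B C : two_arc SigmaG A B C ->
  exists2 p, p \in autg SigmaG & [/\ p A = cell false 1, p B = cell true 1
    & p C = cell false (yelt (delta_mx 0 0)%R)].
Proof.
case/and3P=> /SigmaP[b [g [-> ->]]] BC AC.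
have [w0 w0s _] := @wreath_exists m b (fun=> 1%:M%R) (fun=> unitmx1 _ _).
pose r := bp (right_reg gT g^-1) * bp (theta w0).
have rA : r \in autg SigmaG by rewrite groupM ?right_reg_Sigma ?theta_Sigma.
have rE c : r (cell c g) = cell (c (+) b) 1.
  by rewrite permM right_reg_cell theta_cell mulgV wact_eq1 w0s.
have: SigmaG (r (cell (~~ b) g)) (r C) by rewrite (autgP _ _ rA).
have: r (cell b g) != r C by rewrite (inj_eq perm_inj).
rewrite !rE addbb addNb addbb /= => ne /SigmaP[c [h [/eqP]]].
rewrite cell_eq coord1 => /eqP[<- /esym c0 /esym d0] rC.
have v0 : pc false h != 0%R.
  apply: contraNneq ne => v0; rewrite rC; apply/eqP.
  suff -> : h = 1 by [].
  by apply: (@eq_elt true); rewrite ?coord1 /coord ?c0 ?d0 ?pc1.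
have [N uN EN] := row_transitive v0.
have [|w ws wN] := @wreath_exists m false (fun b => if b then 1%:M else N)%R.
  by case; rewrite ?unitmx1.
exists (r * bp (theta w)); first by rewrite groupM ?theta_Sigma.
split; rewrite permM ?rE ?rC theta_cell ?wact_eq1 ws ?addbF ?addNb ?addbb //.
apply/eqP; rewrite cell_eq (coord_edge (false, _)).
have := coord_wact w false h; rewrite ws !wN EN => ->.
have -> : pd false h = 0%R.
  by rewrite (pdN true) c0 d0 !trmx0 mul0mx addr0.
by rewrite mulmx0 mul0mx.
Qed.

Lemma Sigma_two_arc_transitive : two_arc_transitive SigmaG.
Proof.
move=> A B C A' B' C' /two_arc_std[p pA [pA1 pB1 pC1]] /two_arc_std[q qA [qA1 qB1 qC1]].
exists (p * q^-1); first by rewrite groupM ?groupV.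
by rewrite !permM pA1 pB1 pC1 -qA1 -qB1 -qC1 !permK.
Qed.

(** * The N-orbits and the normal quotient *)

Definition NG : {group {perm block cosetsXY}} := on_Sigma GX GY G^`(1)%G.
Definition GSigma : {group {perm block cosetsXY}} := on_Sigma GX GY G.

Lemma GSigmaP q : reflect (exists k, q = bp (right_reg gT k)) (q \in GSigma).
Proof.
apply: (iffP idP) => [/morphimP[_ _ /morphimP[k _ _ ->] ->]|[k ->]]; first by exists k.
apply: mem_morphim; last by rewrite mem_morphim ?inE.
by rewrite KG_dom // right_reg_in.
Qed.

Lemma NGP q : reflect (exists2 k, forall b, pc b k = 0%R & q = bp (right_reg gT k)) (q \in NG).
Proof.
apply: (iffP idP) => [/morphimP[_ _ /morphimP[k _ + ->] ->]|[k k0 ->]].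
  by rewrite /= der_ker => /ker_psiP k0; exists k.
apply: mem_morphim; first by rewrite KG_dom // right_reg_in.
rewrite mem_morphim ?inE //= der_ker; exact/ker_psiP.
Qed.

(** The derived subgroup is characteristic in the group of translations, which is normal in [KG]. *)
Lemma NG_aut : NG <| autg SigmaG.
Proof.
rewrite autSigmaE; apply: morphim_normal; rewrite /= morphim_der //.
apply: char_normal_trans (der_char 1 _) _.
by rewrite /normal joing_subl join_subG normG RG_norm.
Qed.

Lemma GSigma_aut : GSigma <| autg SigmaG.
Proof.
rewrite autSigmaE; apply: morphim_normal.
by rewrite /normal joing_subl join_subG normG RG_norm.
Qed.

Lemma NG_GSigma : NG <| GSigma.
Proof. by apply: morphim_normal; apply: morphim_normal; apply: der_normal. Qed.

(** Multiplication by the derived subgroup changes only the matrix, and changes it arbitrarily, so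
    side and vector label the N-orbits. *)
Definition vclass (A : block cosetsXY) : bool * rV := ((vcoord A).1, (vcoord A).2.1).
Definition class_set (c : bool * rV) := [set A | vclass A == c].

Lemma vclass_cell b g : vclass (cell b g) = (b, pc b g).
Proof. by rewrite /vclass vcoord_cell. Qed.

Lemma orbit_class_set A : orbit 'P NG A = class_set (vclass A).
Proof.
have [b [g ->]] := cellP A; apply/setP=> B; rewrite inE vclass_cell.
apply/imsetP/eqP => [[_ /NGP[k k0 ->] ->]|].
  by rewrite /= apermE right_reg_cell vclass_cell pcM k0 addr0.
have [c [h ->]] := cellP B; rewrite vclass_cell => -[-> E].
(* Both vectors of [z] vanish, so it lies in the derived subgroup; its matrix is the difference of
   the two vertices. *)
pose z := edge (b, (0, pd b h - pd b g))%R 0%R.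
exists (bp (right_reg gT z)).
  apply/NGP; exists z => // d; case: (eqVneq d b) => [->|db]; first exact: pc_edgeE.
  have -> : d = ~~ b by case: d b db {z E} => [] [].
  exact: (pc_edge (b, _)).
rewrite /= apermE right_reg_cell; apply/eqP; rewrite cell_eq /coord pcM pdM E.
by rewrite pc_edgeE pd_edgeE (pc_edge (b, _)) trmx0 mul0mx !addr0 addrC subrK.
Qed.

Lemma vclass_of_vcoord c : vclass (of_vcoord (c.1, (c.2, 0%R))) = c.
Proof. by rewrite /vclass of_vcoordK; case: c. Qed.

Lemma class_set_orbits c : class_set c \in orbits NG.
Proof. by rewrite -(vclass_of_vcoord c) -orbit_class_set imset_f. Qed.

Definition class_block c : block (orbits NG) := Block (class_set_orbits c).

Lemma class_set_inj : injective class_set.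
Proof.
move=> c d /setP/(_ (of_vcoord (c.1, (c.2, 0%R)))).
by rewrite !inE vclass_of_vcoord eqxx => /esym/eqP.
Qed.

Lemma class_block_inj : injective class_block.
Proof. by move=> c d /(congr1 (@block_set _ _)) /class_set_inj. Qed.

Lemma class_block_exists (B : block (orbits NG)) : exists c, B == class_block c.
Proof.
case: B => S SP; have /imsetP[A _ E] := SP; exists (vclass A).
by rewrite -val_eqE /= E orbit_class_set.
Qed.

Definition block_class B := xchoose (class_block_exists B).
Lemma block_classK : cancel block_class class_block.
Proof. by move=> B; apply/esym/eqP/(xchooseP (class_block_exists B)). Qed.
Lemma class_blockK : cancel class_block block_class.
Proof. by move=> c; apply: class_block_inj; rewrite block_classK. Qed.

Notation QG := (quotient_graph SigmaG NG).

Lemma QG_class_block c d : QG (class_block c) (class_block d) = (c.1 != d.1).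
Proof.
rewrite /quotient_graph (inj_eq class_block_inj); apply/andP/idP => [[_ /exists_inP[A]]|cd].
  rewrite inE => /eqP <- /exists_inP[B]; rewrite inE => /eqP <- /SigmaP[b [g [-> ->]]].
  by rewrite !vclass_cell; case: b.
split; first by apply: contraNneq cd => ->.
apply/exists_inP; exists (of_vcoord (c.1, (c.2, 0%R))); first by rewrite inE vclass_of_vcoord.
(* Every vertex has a neighbour with any prescribed vector, so all classes on opposite sides are
   joined. *)
apply/exists_inP; exists (of_vcoord (neighbor (c.1, (c.2, 0%R)) d.2)).
  by rewrite inE /vclass of_vcoordK /=; case: c d cd => [[] ?] [[] ?].
by rewrite Sigma_adj !of_vcoordK adj_neighbor.
Qed.

Lemma card_rV2 : #|{: rV}| = (2 ^ n)%N.
Proof. by rewrite card_mx card_Fp // mul1n. Qed.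

Definition rk (v : rV) : 'I_(2 ^ n) := cast_ord card_rV2 (enum_rank v).
Definition unrk (i : 'I_(2 ^ n)) : rV := enum_val (cast_ord (esym card_rV2) i).
Lemma rkK : cancel rk unrk.
Proof. by move=> v; rewrite /unrk /rk cast_ordK enum_rankK. Qed.
Lemma unrkK : cancel unrk rk.
Proof. by move=> i; rewrite /unrk /rk enum_valK cast_ordKV. Qed.

Lemma QG_iso : graph_iso QG (@complete_bipartite (2 ^ n)).
Proof.
pose f B := let c := block_class B in if c.1 then inr (rk c.2) else inl (rk c.2).
pose g x := match x with inl i => class_block (false, unrk i) | inr i => class_block (true, unrk i) end.
exists f.
  exists g => [B|[] i]; rewrite /f ?class_blockK /= ?unrkK //.
  rewrite -[RHS]block_classK; case: (block_class B) => [[] v] /=; by rewrite rkK.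
move=> B C; rewrite -[B]block_classK -[C]block_classK QG_class_block /f !class_blockK.
by case: (block_class B) (block_class C) => [[] v] [[] w].
Qed.

Lemma Sigma_valency : has_valency SigmaG (2 ^ n).
Proof.
move=> A; have injf : injective (fun w => of_vcoord (neighbor (vcoord A) w)).
  by move=> v w /of_vcoord_inj[].
rewrite -card_rV2 -(card_imset _ injf); apply: eq_card => B; rewrite inE Sigma_adj.
apply/eqP/imsetP => [E|[w _ ->]]; last by rewrite of_vcoordK.
by exists (vcoord B).2.1 => //; rewrite -E vcoordK.
Qed.

Lemma complete_bipartite_valency k : has_valency (@complete_bipartite k) k.
Proof.
case=> i; rewrite -[RHS]card_ord.
  rewrite -(card_imset _ (@inr_inj 'I_k 'I_k)); apply: eq_card => -[j|j]; rewrite inE.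
    by apply/esym/negbTE/negP => /imsetP[].
  by rewrite imset_f.
rewrite -(card_imset _ (@inl_inj 'I_k 'I_k)); apply: eq_card => -[j|j]; rewrite inE.
  by rewrite imset_f.
by apply/esym/negbTE/negP => /imsetP[].
Qed.

Lemma autSigma_trans : [transitive autg SigmaG, on [set: block cosetsXY] | 'P].
Proof.
apply/imsetP; exists (cell false 1); rewrite ?inE //; apply/esym/setP=> A; rewrite inE.
have [b [g ->]] := cellP A.
have [w0 w0s _] := @wreath_exists m b (fun=> 1%:M%R) (fun=> unitmx1 _ _).
apply/imsetP; exists (bp (theta w0) * bp (right_reg gT g)).
  by rewrite groupM ?right_reg_Sigma ?theta_Sigma.
by rewrite /= apermE permM theta_cell right_reg_cell wact_eq1 w0s mul1g.
Qed.

Lemma Sigma_cover : normal_cover SigmaG NG (@complete_bipartite (2 ^ n)).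
Proof.
exists (autg_group SigmaG); split=> //.
- exact: NG_aut.
- exact: autSigma_trans.
- exact: QG_iso.
by exists (2 ^ n)%N; split; [exact: Sigma_valency | exact: complete_bipartite_valency].
Qed.

Lemma card_class_set c : #|class_set c| = #|{: M}|.
Proof.
have injf : injective (fun A => of_vcoord (c.1, (c.2, A))) by move=> A B /of_vcoord_inj[].
rewrite -(card_imset _ injf); apply: eq_card => A; rewrite inE.
apply/eqP/imsetP => [<-|[B _ ->]]; last by rewrite /vclass of_vcoordK; case: (c).
by exists (vcoord A).2.2 => //; rewrite -[LHS]vcoordK /vclass; case: (vcoord A) => b [v B].
Qed.

(** * The affine action induced on the quotient *)

Lemma autSigma_class_set q : q \in autg SigmaG -> exists k w,
  q = bp (right_reg gT k * theta w) /\ forall b v, q @: class_set (b, v) =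
    class_set (b (+) wswap w, ((v + pc b k) *m wmx w (b (+) wswap w))%R).
Proof.
rewrite autSigmaE => /morphimP[r _ /KGP[k [w Er]] Eq].
exists k, w; split; first by rewrite Eq Er.
move=> b v; apply/eqP; rewrite eqEcard card_imset ?card_class_set ?leqnn ?andbT; last exact: perm_inj.
apply/subsetP=> _ /imsetP[A + ->]; have [c [g ->]] := cellP A.
rewrite !inE vclass_cell => /eqP[-> <-].
rewrite Eq Er morphM ?KG_dom ?right_reg_in ?theta_in // permM right_reg_cell theta_cell.
by rewrite vclass_cell pc_wact pcM.
Qed.

Notation bq := (block_perm (orbits NG)).

Lemma orbits_dom : autg SigmaG \subset block_dom (orbits NG).
Proof.
apply/subsetP=> q /autSigma_class_set[k [w [_ Eq]]]; apply: block_domP => S SP.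
have [[b v] /eqP/(congr1 (@block_set _ _)) /= ->] := class_block_exists (Block SP).
by rewrite Eq class_set_orbits.
Qed.

Lemma bq_class_block q c d : q \in autg SigmaG -> q @: class_set c = class_set d -> bq q (class_block c) = class_block d.
Proof.
by move=> qA E; apply: val_inj; rewrite /= block_permE // (subsetP orbits_dom).
Qed.

Lemma right_reg_class_set k b v :
  bp (right_reg gT k) @: class_set (b, v) = class_set (b, (v + pc b k)%R).
Proof.
apply/eqP; rewrite eqEcard card_imset ?card_class_set ?leqnn ?andbT; last exact: perm_inj.
apply/subsetP=> _ /imsetP[A + ->]; have [c [g ->]] := cellP A.
by rewrite !inE vclass_cell => /eqP[-> <-]; rewrite right_reg_cell vclass_cell pcM.
Qed.

Lemma bq_GSigma k b v :
  bq (bp (right_reg gT k)) (class_block (b, v)) = class_block (b, (v + pc b k)%R).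
Proof. by apply: bq_class_block; rewrite ?right_reg_Sigma ?right_reg_class_set. Qed.

Lemma bq_aut q : q \in autg SigmaG -> bq q \in autg QG.
Proof.
move=> qA; have [k [w [_ Eq]]] := autSigma_class_set qA; apply/autgP=> B C.
rewrite -[B]block_classK -[C]block_classK; case: (block_class B) (block_class C) => [b v] [c w'].
by rewrite !(bq_class_block qA (Eq _ _)) !QG_class_block /= (inj_eq (@addIb _)).
Qed.

(** Evaluating the affine action at the zero vector shows that the translation has zero vectors, and
    at basis vectors that both matrices are the identity. Only multiplication by an element of the
    derived subgroup is left. *)
Lemma bq_ker q : q \in autg SigmaG -> bq q = 1 -> q \in NG.
Proof.
move=> qA q1; have [k [w [E Eq]]] := autSigma_class_set qA.
have {}Eq b v : (b (+) wswap w, ((v + pc b k) *m wmx w (b (+) wswap w))%R) = (b, v).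
  by apply: class_block_inj; rewrite -(bq_class_block qA (Eq b v)) q1 perm1.
have s0 : wswap w = false by have [] := Eq false 0%R.
rewrite s0 in Eq.
have k0 b : pc b k = 0%R.
  have [_] := Eq b 0%R; rewrite add0r addbF => /(congr1 (mulmx^~ (invmx (wmx w b)))).
  by rewrite /= mulmxK ?wmx_unit // mul0mx.
have w1 : w = 1.
  apply: wreath_eq1 => // b; apply/row_matrixP=> i; rewrite !rowE mulmx1.
  by have [_] := Eq b (delta_mx 0 i)%R; rewrite k0 addr0 addbF.
by apply/NGP; exists k; rewrite // E w1 morph1 mulg1.
Qed.

(* G/G' acts on the quotient by translating the vectors, with a different
   factor of (F_2^n)^2 on each side of the bipartition. *)
Definition chi_fun (t : rV * rV) (B : block (orbits NG)) :=
  let c := block_class B in class_block (c.1, (c.2 + if c.1 then t.1 else t.2)%R).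
Lemma chi_funM t u B : chi_fun (t * u) B = chi_fun u (chi_fun t B).
Proof.
rewrite /chi_fun !class_blockK; case: (block_class B) => [b v] /=.
by rewrite -addrA; case: b.
Qed.
Lemma chi_fun1 B : chi_fun 1 B = B.
Proof.
rewrite /chi_fun -[RHS]block_classK; case: (block_class B) => [b v] /=.
by case: b; rewrite addr0.
Qed.
Lemma chi_funK t : cancel (chi_fun t) (chi_fun t^-1).
Proof. by move=> B; rewrite -chi_funM mulgV chi_fun1. Qed.
Definition chi t := perm (can_inj (chi_funK t)).
Lemma chi_class_block t b v : chi t (class_block (b, v)) = class_block (b, (v + if b then t.1 else t.2)%R).
Proof. by rewrite permE /chi_fun class_blockK. Qed.
Lemma chiM : {in [set: rV * rV] &, {morph chi : t u / t * u}}.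
Proof. by move=> t u _ _; apply/permP=> B; rewrite permM !permE chi_funM. Qed.
Canonical chi_morphism := Morphism chiM.

Lemma chi_inj : 'injm chi.
Proof.
apply/subsetP=> -[x y] /morphpreP[_] /set1P E; rewrite inE; apply/eqP.
have := chi_class_block (x, y) true 0%R; have := chi_class_block (x, y) false 0%R.
by rewrite E !perm1 !add0r => /class_block_inj[<-] /class_block_inj[<-].
Qed.

Lemma bq_chi k : bq (bp (right_reg gT k)) = chi (psi k).
Proof.
apply/permP=> B; rewrite -[B]block_classK; case: (block_class B) => b v.
by rewrite bq_GSigma chi_class_block; case: b.
Qed.

Lemma psi_surj t : exists k, psi k = t.
Proof.
exists (edge (false, (t.2, 0%R)) t.1); rewrite /psi pc_edgeE pc_edgeF; by case: t.
Qed.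

Definition MG : {group {perm block (orbits NG)}} := (bq @* GSigma)%G.

Lemma MGP q : reflect (exists t, q = chi t) (q \in MG).
Proof.
apply: (iffP idP) => [/morphimP[_ _ /GSigmaP[k ->] ->]|[t ->]].
  by exists (psi k); rewrite bq_chi.
have [k <-] := psi_surj t; rewrite -bq_chi mem_morphim //; last by apply/GSigmaP; exists k.
by rewrite (subsetP orbits_dom) // right_reg_Sigma.
Qed.

Lemma MG_isog : MG \isog setX [set: rV] [set: rV].
Proof.
have -> : MG = (chi @* [set: rV * rV])%G.
  apply/val_inj/setP=> q; apply/MGP/morphimP => [[t ->]|[t _ _ ->]]; by exists t; rewrite ?inE.
have -> : setX [set: rV] [set: rV] = [set: rV * rV] by apply/setP=> t; rewrite !inE.
by rewrite isog_sym; apply: sub_isog => //; apply: chi_inj.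
Qed.

Lemma QG_edge E : E \in edges QG -> exists v w, E = [set class_block (false, v); class_block (true, w)].
Proof.
case/imsetP=> -[B C] /=; rewrite inE /= -[B]block_classK -[C]block_classK QG_class_block.
case: (block_class B) (block_class C) => [[] v] [[] w] //= _ ->.
  by exists w, v; rewrite setUC.
by exists v, w.
Qed.

Lemma chi_edge t v w : 'P^*%act [set class_block (false, v); class_block (true, w)] (chi t) =
  [set class_block (false, v + t.2)%R; class_block (true, w + t.1)%R].
Proof. by rewrite /= /setact imsetU1 imset_set1 /= !apermE !chi_class_block. Qed.

Lemma mem_edge v w : [set class_block (false, v); class_block (true, w)] \in edges QG.
Proof. by apply/imsetP; exists (class_block (false, v), class_block (true, w)); rewrite // inE QG_class_block. Qed.

(** A general [L] treats Aut(Sigma) and G(n) together. The required normal subgroup is the image of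
    G(n), which translates the two sides independently. *)
Lemma Sigma_edge_affine (L : {group {perm block cosetsXY}}) :
    NG <| L -> GSigma <| L -> L \subset autg SigmaG ->
  quotient_edge_affine n SigmaG L NG.
Proof.
move=> nNL nGL sLA; have sLD := subset_trans sLA orbits_dom.
split=> //.
  apply/eqP; rewrite eqEsubset; apply/andP; split.
    apply/subsetP=> q /setIP[qL /kerP q1]; apply: bq_ker; rewrite ?(subsetP sLA) //.
    by apply: q1; rewrite (subsetP sLD).
  apply/subsetP=> q qN; have qL := subsetP (normal_sub nNL) q qN.
  rewrite inE qL; apply/kerP; first exact: (subsetP sLD).
  have /NGP[k k0 ->] := qN; rewrite bq_chi /psi !k0; exact: (morph1 chi_morphism).
split; first exact: QG_iso.
  apply/subsetP=> _ /morphimP[q _ qL ->]; apply: bq_aut; exact: (subsetP sLA).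
exists MG; split.
- exact: morphim_normal.
- exact: MG_isog.
- apply/negP=> tr.
  have [q /MGP[t ->]] := atransP2 tr (in_setT (class_block (false, 0%R))) (in_setT (class_block (true, 0%R))).
  by rewrite /= apermE chi_class_block => /class_block_inj.
- apply/imsetP; exists [set class_block (false, 0%R); class_block (true, 0%R)]; first exact: mem_edge.
  apply/setP=> E; apply/idP/imsetP => [/QG_edge[v [w ->]]|[_ /MGP[t ->] ->]].
    (* [chi] takes the translation of side [true] first, hence the reversed order. *)
    exists (chi (w, v)); first by apply/MGP; exists (w, v).
    by rewrite chi_edge !add0r.
  by rewrite chi_edge mem_edge.
move=> E /QG_edge[v [w ->]]; apply/trivgP/subsetP=> _ /setIP[/MGP[t ->] /astab1P].
(* Translations preserve each side, so an edge fixed as a set has both ends fixed, and both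
   translation vectors vanish. *)
rewrite chi_edge => /setP E2; rewrite inE; apply/eqP.
have := E2 (class_block (false, v)); have := E2 (class_block (true, w)).
rewrite !inE !(inj_eq class_block_inj) !xpair_eqE !eqxx /= orbF.
move=> /eqP/esym t1 /eqP/esym t2.
have -> : t = (0, 0)%R.
  case: t t1 t2 {E2} => x y /= t1 t2.
  by congr (_, _); [apply: (addrI w) | apply: (addrI v)]; rewrite ?t1 ?t2 addr0.
exact: (morph1 chi_morphism).
Qed.

End Coordinatized.

(** * Coordinates on the mixed dihedral group *)
Section CalGCoordinates.
Local Open Scope ring_scope.
Variables (m : nat) (X Y : vectType 'F_2).
Hypotheses (dimX : \dim {:X} = m.+2) (dimY : \dim {:Y} = m.+2).
Notation n := m.+2.
Notation rV := 'rV['F_2]_n.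
Notation M := 'M['F_2]_n.

(** The coordinate rows have length [\dim {:X}], equal to n only through a hypothesis; [castmx]
    brings them to the size used in the model. *)
Definition xrow (g : calG X Y) : rV := castmx (erefl 1%N, dimX) (coords (xpart g)).
Definition yrow (g : calG X Y) : rV := castmx (erefl 1%N, dimY) (coords (ypart g)).
Definition tmx (g : calG X Y) : M := castmx (dimX, dimY) (tpart g).
Definition of_rows (x y : rV) (A : M) : calG X Y :=
  CalG (of_coords (castmx (erefl 1%N, esym dimX) x))
       (of_coords (castmx (erefl 1%N, esym dimY) y))
       (castmx (esym dimX, esym dimY) A : tensor X Y).

Lemma castmxD m1 m2 n1 n2 (e : (m1 = m2) * (n1 = n2)) (A B : 'M['F_2]_(m1, n1)) :
  castmx e (A + B) = castmx e A + castmx e B.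
Proof. by case: e => e1 e2; case: _ / e1; case: _ / e2; rewrite !castmx_id. Qed.

Lemma castmx_tens k1 k2 (e1 : k1 = n) (e2 : k2 = n) (x : 'rV['F_2]_k1) (y : 'rV['F_2]_k2) :
  castmx (e1, e2) (x^T *m y) =
  (castmx (erefl 1%N, e1) x)^T *m castmx (erefl 1%N, e2) y.
Proof. by subst k1 k2; rewrite !castmx_id. Qed.

Lemma xrowM g h : xrow (g * h)%g = xrow g + xrow h.
Proof. by rewrite /xrow calG_mulE /= linearD castmxD. Qed.
Lemma yrowM g h : yrow (g * h)%g = yrow g + yrow h.
Proof. by rewrite /yrow calG_mulE /= linearD castmxD. Qed.
Lemma tmxM g h : tmx (g * h)%g = tmx g + tmx h + (xrow h)^T *m yrow g.
Proof. by rewrite /tmx calG_mulE /= !castmxD /tens castmx_tens. Qed.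

Lemma xrowK x y A : xrow (of_rows x y A) = x.
Proof. by rewrite /xrow /= of_coordsK castmx_comp castmx_id. Qed.
Lemma yrowK x y A : yrow (of_rows x y A) = y.
Proof. by rewrite /yrow /= of_coordsK castmx_comp castmx_id. Qed.
Lemma tmxK x y A : tmx (of_rows x y A) = A.
Proof. by rewrite /tmx /= castmx_comp castmx_id. Qed.
Lemma of_rowsK g : of_rows (xrow g) (yrow g) (tmx g) = g.
Proof.
case: g => x y A; rewrite /of_rows /xrow /yrow /tmx /= !castmx_comp !castmx_id.
by rewrite !coordsK.
Qed.

Definition calG_vec (b : bool) g := if b then xrow g else yrow g.
Definition calG_mat (b : bool) g :=
  if b then (tmx g + (xrow g)^T *m yrow g)^T else tmx g.
(** On side [true] the matrix coordinate is the transpose of the tensor part plus x (x) y; solving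
    for the tensor part gives [A^T + v^T *m w]. *)
Definition calG_edge (u : bool * (rV * M)) (w : rV) :=
  let: (b, (v, A)) := u in
  if b then of_rows v w (A^T + v^T *m w) else of_rows w v A.

Lemma calG_edge_vec u w : calG_vec u.1 (calG_edge u w) = u.2.1.
Proof. by case: u => [[] [v A]] /=; rewrite ?xrowK ?yrowK. Qed.
Lemma calG_edge_vecN u w : calG_vec (~~ u.1) (calG_edge u w) = w.
Proof. by case: u => [[] [v A]] /=; rewrite ?xrowK ?yrowK. Qed.
Lemma calG_edge_mat u w : calG_mat u.1 (calG_edge u w) = u.2.2.
Proof.
by case: u => [[] [v A]] /=; rewrite tmxK ?xrowK ?yrowK //; mxchar2.
Qed.
Lemma calG_vecM b g h : calG_vec b (g * h)%g = calG_vec b g + calG_vec b h.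
Proof. by case: b; rewrite /calG_vec ?xrowM ?yrowM. Qed.
Lemma calG_matM b g h : calG_mat b (g * h)%g =
  calG_mat b g + calG_mat b h + (calG_vec (~~ b) h)^T *m calG_vec b g.
Proof.
by case: b; rewrite /calG_mat /calG_vec /= tmxM ?xrowM ?yrowM //; mxchar2.
Qed.
Lemma calG_matN b g : calG_mat (~~ b) g =
  (calG_mat b g)^T + (calG_vec b g)^T *m calG_vec (~~ b) g.
Proof. by case: b; rewrite /calG_mat /calG_vec /=; mxchar2. Qed.
Lemma calG_coord_inj g h :
  (forall b, calG_vec b g = calG_vec b h /\ calG_mat b g = calG_mat b h) -> g = h.
Proof.
move=> E; have [/= ex _] := E true; have [/= ey et] := E false.
by rewrite -(of_rowsK g) ex ey et of_rowsK.
Qed.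

Lemma xrow_eq0 g : (xrow g == 0) = (xpart g == 0).
Proof.
rewrite -(can_eq (@coordsK X)) linear0 -(inj_eq (can_inj (castmxK (erefl 1%N) dimX))).
by rewrite castmx_const.
Qed.
Lemma yrow_eq0 g : (yrow g == 0) = (ypart g == 0).
Proof.
rewrite -(can_eq (@coordsK Y)) linear0 -(inj_eq (can_inj (castmxK (erefl 1%N) dimY))).
by rewrite castmx_const.
Qed.
Lemma tmx_eq0 g : (tmx g == 0) = (tpart g == 0).
Proof. by rewrite -(inj_eq (can_inj (castmxK dimX dimY))) castmx_const. Qed.

Lemma calG_mem_group b g :
  (g \in (if b then calG_Y_group X Y else calG_X_group X Y)) =
  (calG_vec b g == 0) && (calG_mat b g == 0).
Proof.
case: b; rewrite inE /calG_vec /calG_mat -?xrow_eq0 -?yrow_eq0 -tmx_eq0 //.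
case: eqP => //= ->; rewrite trmx0 mul0mx addr0.
by rewrite -[RHS](inj_eq trmx_inj) trmxK trmx0.
Qed.

Definition calG_coordinates : coordinates m (calG_X_group X Y) (calG_Y_group X Y) :=
  Coordinates calG_vecM calG_matM calG_matN calG_edge_vec calG_edge_mat
    calG_edge_vecN calG_coord_inj calG_mem_group.

End CalGCoordinates.

Theorem lemma5p6 (n : nat) (X Y : vectType 'F_2)
    (hn : (1 < n)%N) (dimX : \dim {:X} = n) (dimY : \dim {:Y} = n) :
  let G : {group calG X Y} := [set: calG X Y]%G in
  let GX := calG_X_group X Y in
  let GY := calG_Y_group X Y in
  let S := connection_set GX GY in
  let AutGamma := autg_group (Gamma X Y) in
  let AutSigma := autg_group (Sigma X Y) in
  let GSigma := on_Sigma GX GY G in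
  let N := on_Sigma GX GY G^`(1)%G in
  [/\ is_graph (Gamma X Y),
      (* Aut(Gamma) = Aut(Sigma), via the action on the cosets Xh, Yh *)
      AutGamma \subset block_dom (cosets GX GY)
        /\ misom AutGamma AutSigma (block_perm (cosets GX GY)),
      right_reg (calG X Y) @* G ><| aut_set S = AutGamma,
      aut_set S \isog [set: wreath {'GL_n['F_2]} 2]
    & isog_semidirect AutGamma G [set: wreath {'GL_n['F_2]} 2]%G]
  /\
  [/\ is_graph (Sigma X Y) /\ two_arc_transitive (Sigma X Y),
      #|{: block (cosets GX GY)}| = (2 ^ (n ^ 2 + n + 1))%N,
      normal_cover (Sigma X Y) N (@complete_bipartite (2 ^ n)),
      quotient_edge_affine n (Sigma X Y) AutSigma N
    & quotient_edge_affine n (Sigma X Y) GSigma N].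
Proof.
(* As n is at least 2 it is written m + 2, the shape on which the model is built. *)
case: n hn dimX dimY => [|[|m]] // _ dimX dimY G GX GY S AutGamma AutSigma GSigma N.
pose co : coordinates m GX GY := calG_coordinates dimX dimY.
split; split.
- exact: (Gamma_is_graph co).
- by split; [exact: (autGamma_dom co) | exact: (block_perm_misom co)].
- exact: (autGamma_sdprod co).
- exact: (aut_set_isog co).
- exact: (autGamma_isog co).
- by split; [exact: (Sigma_is_graph co) | exact: (Sigma_two_arc_transitive co)].
- exact: (card_blocks co).
- exact: (Sigma_cover co).
- apply: (Sigma_edge_affine co) => //; [exact: (NG_aut co) | exact: (GSigma_aut co)].
apply: (Sigma_edge_affine co); [exact: NG_GSigma | exact: normal_refl |].
exact: (normal_sub (GSigma_aut co)).
Qed.
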